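(* Let $\mathcal D=(G,\chi,a)$ be data, and let $\ell=|\chi(a)|$, $N=|a|$, $M=|\chi|$. Then the map $$\Phi:\mathcal S_{\overline{D(H_{\mathcal D})}}\times\mathcal S^1_{D(H_{\mathcal D})}\to\mathcal S_{D(H_{\mathcal D})},\qquad\Phi([U],[V])=[U\otimes V],$$ is a bijection if and only if $\ell$ is odd and $\ell=M=N$.
   Context: $\mathbb K$ is an algebraically closed field of characteristic $0$; all vector spaces and tensor products are over $\mathbb K$, and modules are left modules. $|\cdot|$ of a group element denotes its order ($\chi(a)$ is viewed in $\mathbb K^\times$, $a$ in $G$, and $\chi$ in the group $\mathrm{Hom}(G,\mathbb K^\times)$). Data $\mathcal D=(G,\chi,a)$ is a triple consisting of a finite abelian group $G$, a character $\chi:G\to\mathbb K^\times$ and an element $a\in G$. With $\ell=|\chi(a)|$, $H_{\mathcal D}$ is the Hopf algebra generated as a $\mathbb K$-algebra by $G$ and $x$, with the relations of $G$, $x^\ell=0$, and $xg=\chi(g)gx$ for all $g\in G$, and with coalgebra structure given by $\Delta(x)=x\otimes a+1\otimes x$ and $\Delta(g)=g\otimes g$ for all $g\in G$. For a finite-dimensional Hopf algebra $H$ with antipode $S$, the Drinfel'd double is $D(H)=(H^* )^{\mathrm{coop}}\otimes H$ as a coalgebra (where coop denotes the opposite comultiplication), with product $$(g\otimes h)(f\otimes k)=\sum g\,\bigl(h_{(1)}\rightharpoonup f\leftharpoonup S^{-1}(h_{(3)})\bigr)\otimes h_{(2)}k$$ for $g,f\in H^*$ and $h,k\in H$, where $\langle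 b\rightharpoonup f,c\rangle=\langle f,cb\rangle$ and $\langle f\leftharpoonup b,c\rangle=\langle f,bc\rangle$ for $b,c\in H$; it is a Hopf algebra. For a finite-dimensional Hopf algebra $A$ with counit $\epsilon$: $G_C(A)$ is the group of central group-like elements of $A$, and $\overline A=A/A(\mathbb KG_C(A))^+$, where $(\mathbb KG_C(A))^+=\mathbb KG_C(A)\cap\ker\epsilon$ is the span of $\{g-1:g\in G_C(A)\}$; $\overline A$ is a Hopf algebra. $\mathcal S_A$ is the set of isomorphism classes $[M]$ of simple $A$-modules $M$, and $\mathcal S^1_A\subset\mathcal S_A$ is the subset of classes of one-dimensional modules. $\mathcal S_{\overline A}$ is identified with the subset of $\mathcal S_A$ consisting of the classes of simple $A$-modules that are naturally $\overline A$-modules, i.e. on which the action of $A$ factors through the quotient map $A\to\overline A$. The tensor product $U\otimes V$ of $A$-modules is an $A$-module via the comultiplication of $A$.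
   Formalization: Data with ℓ=1 are excluded unless N=M=1: if χ(a)=1 then x=0, D(H_D) is commutative and spanned by central group-likes, so Φ is always a bijection, and the stated equivalence is false when χ or a is nontrivial (e.g. G=Z/2, χ=1, a≠1). *)

(* Defs.v *)
From HB Require Import structures.
From mathcomp Require Import all_boot all_order all_algebra all_fingroup all_field.
From mathcomp Require Import boolp.

Set Implicit Arguments.
Unset Strict Implicit.
Unset Printing Implicit Defensive.

Import GRing.Theory.
Local Open Scope ring_scope.

Section Tensor.
Variable K : fieldType.

(* The tensor product of two finite-dimensional spaces, in coordinates with
   respect to the bases [vbasis {:U}] and [vbasis {:V}]. *)
Definition tens (U V : vectType K) : vectType K :=
  'M[K]_(\dim {:U}, \dim {:V}).

Definition tpure (U V : vectType K) (u : U) (v : V) : tens U V :=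
  \matrix_(i, j) (coord (vbasis {:U}) i u * coord (vbasis {:V}) j v).

(* For a bilinear [f], the linear map induced on the tensor product (see
   [tlift_tpure]). Sweedler sums are written with it: the sum of the
   [f h_(1) h_(2)] is [tlift f (comul h)]. *)
Definition tlift (U V W : vectType K) (f : U -> V -> W) (t : tens U V) : W :=
  \sum_i \sum_j t i j *: f (vbasis {:U})`_i (vbasis {:V})`_j.

Definition bilin (U V W : vectType K) (f : U -> V -> W) : Prop :=
  (forall v, linear (f^~ v)) /\ (forall u, linear (f u)).

Lemma tlift_linear (U V W : vectType K) (f : U -> V -> W) : linear (tlift f).
Proof.
move=> c s t; rewrite /tlift scaler_sumr -big_split /=; apply: eq_bigr => i _.
rewrite scaler_sumr -big_split /=; apply: eq_bigr => j _.
by rewrite !mxE scalerDl scalerA.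
Qed.

Lemma linear_sumZ (U V : vectType K) (f : U -> V) (hf : linear f)
    n (c : 'I_n -> K) (e : 'I_n -> U) :
  f (\sum_i c i *: e i) = \sum_i c i *: f (e i).
Proof.
pose L := GRing.isLinear.Build K U V *:%R f hf.
pose g : {linear U -> V} := HB.pack f L.
rewrite -[f]/(g : U -> V) linear_sum; apply: eq_bigr => i _; exact: linearZ.
Qed.

Lemma coord_vbasis_full (U : vectType K) (u : U) :
  \sum_i coord (vbasis {:U}) i u *: (vbasis {:U})`_i = u.
Proof. by rewrite [RHS](coord_vbasis (memvf u)). Qed.

Lemma tlift_tpure (U V W : vectType K) (f : U -> V -> W) (u : U) (v : V) :
  bilin f -> tlift f (tpure u v) = f u v.
Proof.
case=> fl fr; rewrite -{2}[u]coord_vbasis_full -{2}[v]coord_vbasis_full.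
rewrite (linear_sumZ (fl _)); apply: eq_bigr => i _.
rewrite (linear_sumZ (fr _)) scaler_sumr; apply: eq_bigr => j _.
by rewrite mxE scalerA.
Qed.

Lemma tlift_comp (U V W X : vectType K) (f : U -> V -> W) (g : W -> X) t :
  linear g -> g (tlift f t) = tlift (fun u v => g (f u v)) t.
Proof.
move=> hg; pose L := GRing.isLinear.Build K W X *:%R g hg.
pose G : {linear W -> X} := HB.pack g L.
rewrite /tlift -[g]/(G : W -> X) linear_sum; apply: eq_bigr => i _.
by rewrite linear_sum; apply: eq_bigr => j _; exact: linearZ.
Qed.

Lemma eq_tlift (U V W : vectType K) (f g : U -> V -> W) t :
  (forall u v, f u v = g u v) -> tlift f t = tlift g t.
Proof. by move=> e; do 2!(apply: eq_bigr => ? _); rewrite e. Qed.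

Lemma tpure_bilin (U V : vectType K) : bilin (@tpure U V).
Proof.
split=> [v c x y|u c x y]; apply/matrixP=> i j; rewrite !mxE linearP /=.
  by rewrite mulrDl mulrA.
by rewrite mulrDr mulrCA.
Qed.

Lemma tlift_id (U V : vectType K) (t : tens U V) : tlift (@tpure U V) t = t.
Proof.
have cb (W : vectType K) (k m : 'I_(\dim {:W})) :
  coord (vbasis {:W}) k (vbasis {:W})`_m = (k == m)%:R.
  by rewrite coord_free ?(basis_free (vbasisP _)) // eq_sym.
apply/matrixP=> i j; rewrite /tlift summxE (bigD1 i) //= summxE (bigD1 j) //=.
rewrite !mxE !cb !eqxx !mulr1 !big1 ?addr0 // => [k ki|k kj].
  rewrite summxE big1 // => m _.
  by rewrite !mxE !cb eq_sym (negPf ki) mul0r mulr0.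
by rewrite !mxE !cb [j == k]eq_sym (negPf kj) !mulr0.
Qed.

End Tensor.

Section HopfAlgebra.
Variable K : fieldType.

Record hopfAlg := HopfAlg {
  hcar :> falgType K;
  comul : 'Hom(hcar, tens hcar hcar);
  counit : 'Hom(hcar, K^o);
  antipode : 'End(hcar);
  (* h_(1)_(1) (x) (h_(1)_(2) (x) h_(2)) = h_(1) (x) (h_(2)_(1) (x) h_(2)_(2)) *)
  comulA : forall h,
    tlift (fun u v => tlift (fun u1 u2 => tpure u1 (tpure u2 v)) (comul u))
          (comul h)
    = tlift (fun u v => tpure u (comul v)) (comul h);
  counitl : forall h, tlift (fun u v => (counit u : K) *: v) (comul h) = h;
  counitr : forall h, tlift (fun u v => (counit v : K) *: u) (comul h) = h;
  comul1 : comul 1 = tpure 1 1;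
  comulM : forall h k, comul (h * k) =
    tlift (fun h1 h2 => tlift (fun k1 k2 => tpure (h1 * k1) (h2 * k2))
                              (comul k)) (comul h);
  counit1 : counit 1 = 1;
  counitM : forall h k, counit (h * k) = (counit h : K) * (counit k : K);
  antipodel : forall h,
    tlift (fun u v => antipode u * v) (comul h) = (counit h : K)%:A;
  antipoder : forall h,
    tlift (fun u v => u * antipode v) (comul h) = (counit h : K)%:A
}.

(* The structure maps of a finite-dimensional bialgebra, without the axioms:
   the Drinfel'd double, its modules and their tensor products are given by
   formulas, and everything below makes sense for the bare structure maps. *)
Record bialgOps := BialgOps {
  bcar :> vectType K;
  bmul : bcar -> bcar -> bcar;
  bone : bcar;
  bcomul : bcar -> tens bcar bcar;
  bcounit : bcar -> K
}.

End HopfAlgebra.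

Section DrinfeldDouble.
Variables (K : fieldType) (H : hopfAlg K).

Definition dual : vectType K := 'Hom(H, K^o).

Definition dual_mul (f g : dual) : dual :=
  linfun (fun c : H => tlift (fun c1 c2 => f c1 * g c2 : K^o) (comul H c)).

Definition hit_l (b : H) (f : dual) : dual := linfun (fun c : H => f (c * b)).

Definition hit_r (f : dual) (b : H) : dual := linfun (fun c : H => f (b * c)).

(* [delta_(1) (x) delta_(2)] with [f (b * c) = delta_(1) b * delta_(2) c]:
   the [coord (vbasis {:H}) i] form the basis dual to [vbasis {:H}]. *)
Definition dual_comul (f : dual) : tens dual dual :=
  \sum_(i < \dim {:H}) \sum_(j < \dim {:H}) f ((vbasis {:H})`_i * (vbasis {:H})`_j) *:
    tpure (linfun (fun u : H => coord (vbasis {:H}) i u : K^o) : dual)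
          (linfun (fun u : H => coord (vbasis {:H}) j u : K^o) : dual).

Definition dbl_car : vectType K := tens dual H.

(* (g (x) h)(f (x) k); the antipode of a finite-dimensional Hopf algebra is
   bijective, so [(antipode H)^-1] is its inverse. *)
Definition dbl_mul_pure (g : dual) (h : H) (f : dual) (k : H) : dbl_car :=
  tlift (fun h12 h3 =>
      tlift (fun h1 h2 =>
          tpure (dual_mul g (hit_r (hit_l h1 f) ((antipode H)^-1%VF h3)))
                (h2 * k))
        (comul H h12))
    (comul H h).

Definition dbl_mul (s t : dbl_car) : dbl_car :=
  tlift (fun g h => tlift (fun f k => dbl_mul_pure g h f k) t) s.

Definition dbl_one : dbl_car := tpure (counit H : dual) (1 : H).

(* The first factor carries the opposite comultiplication:
   f (x) h |-> (f_(2) (x) h_(1)) (x) (f_(1) (x) h_(2)). *)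
Definition dbl_comul (t : dbl_car) : tens dbl_car dbl_car :=
  tlift (fun f h =>
      tlift (fun f1 f2 =>
          tlift (fun h1 h2 => tpure (tpure f2 h1) (tpure f1 h2)) (comul H h))
        (dual_comul f))
    t.

Definition dbl_counit (t : dbl_car) : K :=
  tlift (fun (f : dual) (h : H) => (f 1 : K) * (counit H h : K) : K^o) t.

Definition drinfeld_double : bialgOps K :=
  BialgOps dbl_mul dbl_one dbl_comul dbl_counit.

End DrinfeldDouble.

Section Modules.
Variables (K : fieldType) (A : bialgOps K).

(* A space with an operation of [A]; [is_module] adds the module axioms. *)
Record preModule := PreModule {
  mcar :> vectType K;
  mact : A -> mcar -> mcar
}.

Definition is_module (M : preModule) : Prop :=
  [/\ bilin (@mact M),
      forall m : M, mact (bone A) m = m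
    & forall (a b : A) (m : M), mact (bmul a b) m = mact a (mact b m)].

Definition simple_module (M : preModule) : Prop :=
  [/\ is_module M, ({:M} != 0)%VS
    & forall U : {vspace M},
        (forall (a : A) (u : M), u \in U -> mact a u \in U) ->
        U = 0%VS \/ U = fullv].

Definition mod_iso (M M' : preModule) : Prop :=
  exists f : 'Hom(M, M'), bijective f /\
    forall (a : A) (m : M), f (mact a m) = mact a (f m).

(* The predicates on [preModule]; this type is too large for [set]. *)
Definition modClass := preModule -> Prop.

Definition isoclass (M : preModule) : modClass := mod_iso M.

Definition tensor_module (U V : preModule) : preModule :=
  @PreModule (tens U V) (fun a t =>
    tlift (fun a1 a2 => tlift (fun u v => tpure (mact a1 u) (mact a2 v)) t)
          (bcomul a)).

(* The central group-like elements G_C(A). *)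
Definition central_grouplike (g : A) : Prop :=
  [/\ bcomul g = tpure g g, bcounit g = 1
    & forall b : A, bmul g b = bmul b g].

(* (K G_C(A))^+, the intersection of the span of G_C(A) and of ker epsilon. *)
Definition central_aug (y : A) : Prop :=
  (exists2 s : seq A, (forall g, g \in s -> central_grouplike g)
     & y \in <<s>>%VS)
  /\ bcounit y = 0.

(* The ideal A (K G_C(A))^+. *)
Definition central_ideal (z : A) : Prop :=
  exists n (b y : 'I_n -> A),
    (forall i, central_aug (y i)) /\ z = \sum_i bmul (b i) (y i).

(* The action of [A] factors through [A / central_ideal]. *)
Definition bar_module (M : preModule) : Prop :=
  forall z : A, central_ideal z -> forall m : M, mact z m = 0.

(* S_A *)
Definition simples (C : modClass) : Prop :=
  exists2 M, simple_module M & C = isoclass M.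

(* S^1_A *)
Definition simples1 (C : modClass) : Prop :=
  exists M, [/\ simple_module M, \dim {:M} = 1%N & C = isoclass M].

(* S_(A-bar), as a subset of S_A *)
Definition simples_bar (C : modClass) : Prop :=
  exists M, [/\ simple_module M, bar_module M & C = isoclass M].

(* ([U], [V]) |-> [U (x) V]; see [Phi_isoclass]. *)
Definition Phi (C C' : modClass) : modClass :=
  fun W => exists U V, [/\ C U, C' V & mod_iso (tensor_module U V) W].

Definition Phi_maps : Prop := forall C C' : modClass,
  simples_bar C -> simples1 C' -> simples (Phi C C').

Definition Phi_injective : Prop := forall C1 C1' C2 C2' : modClass,
  simples_bar C1 -> simples1 C1' -> simples_bar C2 -> simples1 C2' ->
  Phi C1 C1' = Phi C2 C2' -> C1 = C2 /\ C1' = C2'.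

Definition Phi_surjective : Prop := forall E : modClass, simples E ->
  exists C C', [/\ simples_bar C, simples1 C' & Phi C C' = E].

Lemma mod_iso_refl M : mod_iso M M.
Proof.
exists \1%VF; split; last by move=> a m; rewrite !id_lfunE.
by exists id => m; rewrite id_lfunE.
Qed.

Lemma mod_iso_trans M1 M2 M3 : mod_iso M1 M2 -> mod_iso M2 M3 -> mod_iso M1 M3.
Proof.
move=> [f [fb fa]] [g [gb ga]]; exists (g \o f)%VF; split.
  by apply: (eq_bij (bij_comp gb fb)) => m; rewrite lfunE.
by move=> a m; rewrite !comp_lfunE fa ga.
Qed.

Lemma mod_isoP M1 M2 : mod_iso M1 M2 ->
  exists (f : 'Hom(M1, M2)) (f' : 'Hom(M2, M1)), [/\ cancel f f', cancel f' f
    & forall (a : A) (m : M1), f (mact a m) = mact a (f m)].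
Proof.
move=> [f [fb fa]]; exists f, (f^-1)%VF.
have kf : lker f == 0%VS by apply/lker0P; exact: bij_inj.
have fK : cancel f (f^-1)%VF by exact: lker0_lfunK.
split=> //; case: fb => g gK fg m; rewrite -(fg m).
by congr (f _); exact: fK.
Qed.

Lemma mod_iso_sym M1 M2 : mod_iso M1 M2 -> mod_iso M2 M1.
Proof.
move=> /mod_isoP[f [f' [fK fK' fa]]]; exists f'; split; first by exists f.
by move=> a m; rewrite -[RHS]fK fa !fK'.
Qed.

Lemma isoclass_eq M1 M2 : isoclass M1 = isoclass M2 <-> mod_iso M1 M2.
Proof.
split=> [e|h].
  by have : isoclass M2 M2 := mod_iso_refl M2; rewrite -e.
apply: funext => M; apply: propext; split; apply: mod_iso_trans => //.
exact: mod_iso_sym.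
Qed.

Lemma tensor_module_iso U V U' V' : is_module U -> is_module V ->
  mod_iso U' U -> mod_iso V' V ->
  mod_iso (tensor_module U' V') (tensor_module U V).
Proof.
move=> [[_ hU] _ _] [[_ hV] _ _].
move=> /mod_isoP[f [f' [fK fK' fa]]] /mod_isoP[g [g' [gK gK' ga]]].
have lf' : linear f' by move=> c x y; rewrite linearP.
have lg' : linear g' by move=> c x y; rewrite linearP.
have bil (X1 X2 Y1 Y2 : vectType K) (p : X1 -> Y1) (q : X2 -> Y2) :
    linear p -> linear q -> bilin (fun u v => tpure (p u) (q v)).
  move=> lp lq; split=> [v c x y|u c x y].
    by rewrite lp; case: (tpure_bilin Y1 Y2) => -> _.
  by rewrite lq; case: (tpure_bilin Y1 Y2) => _ ->.
pose F0 t := tlift (fun u v => tpure (f u) (g v)) t.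
pose F' t := tlift (fun u v => tpure (f' u) (g' v)) t.
pose F : 'Hom(tens U' V', tens U V) := linfun F0.
have FE t : F t = F0 t.
  pose L := GRing.isLinear.Build K (tens U' V') (tens U V) *:%R F0
    (tlift_linear (fun u v => tpure (f u) (g v))).
  pose G : {linear tens U' V' -> tens U V} := HB.pack F0 L.
  by rewrite /F -[F0]/(G : _ -> _) lfunE.
exists F; split.
  exists F' => t; rewrite FE /F' /F0 (tlift_comp _ _ (tlift_linear _)).
    rewrite -[RHS]tlift_id; apply: eq_tlift => x y.
    by rewrite tlift_tpure ?fK ?gK //; exact: bil.
  rewrite -[RHS]tlift_id; apply: eq_tlift => x y.
  by rewrite tlift_tpure ?fK' ?gK' //; apply: bil => c ? ?; rewrite linearP.
move=> a t; rewrite !FE /= /F0 (tlift_comp _ _ (tlift_linear _)).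
apply: eq_tlift => a1 a2.
rewrite !(tlift_comp _ _ (tlift_linear _)); apply: eq_tlift => u v.
rewrite !tlift_tpure ?fa ?ga //; first exact: bil.
by apply: bil => c x y; rewrite linearP.
Qed.

Lemma Phi_isoclass U V : is_module U -> is_module V ->
  Phi (isoclass U) (isoclass V) = isoclass (tensor_module U V).
Proof.
move=> mU mV; apply: funext => W; apply: propext; split.
  move=> [U' [V' [UU' VV' h]]]; apply: mod_iso_trans h.
  by apply: mod_iso_sym; apply: tensor_module_iso => //; exact: mod_iso_sym.
by move=> h; exists U, V; split=> //; exact: mod_iso_refl.
Qed.

End Modules.

Section HopfAlgebraOfDatum.
Variables (K : fieldType) (G : finGroupType) (chi : G -> K) (a : G) (l : nat).

Definition datum_rel (B : algType K) (i : G -> B) (x : B) : Prop :=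
  [/\ i 1%g = 1, forall g h, i (g * h)%g = i g * i h, x ^+ l = 0
    & forall g, x * i g = chi g *: (i g * x)].

(* [H], with [i : G -> H] and [x], is presented as an algebra by the relations
   above, and has the comultiplication of H_D; the counit and the antipode are
   determined by the comultiplication. *)
Definition is_hopf_of_datum (H : hopfAlg K) (i : G -> H) (x : H) : Prop :=
  [/\ datum_rel i x,
      forall (B : algType K) (j : G -> B) (y : B), datum_rel j y ->
        exists f : {lrmorphism H -> B},
          [/\ forall g, f (i g) = j g, f x = y
            & forall f' : {lrmorphism H -> B},
                (forall g, f' (i g) = j g) -> f' x = y -> f' =1 f],
      comul H x = tpure x (i a) + tpure 1 x
    & forall g, comul H (i g) = tpure (i g) (i g)].

(* [M] is the order of [chi] in the group of characters of [G]. *)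
Definition char_order (M : nat) : Prop :=
  [/\ (0 < M)%N, forall g, chi g ^+ M = 1
    & forall m : nat, (0 < m)%N -> (forall g, chi g ^+ m = 1) -> (M <= m)%N].

End HopfAlgebraOfDatum.

(* Main.v *)
Require Import Defs.
From HB Require Import structures.
From mathcomp Require Import all_boot all_order all_algebra all_fingroup all_field.
From mathcomp Require Import cyclic boolp ring.

Set Implicit Arguments.
Unset Strict Implicit.
Unset Printing Implicit Defensive.

Import GRing.Theory.
Local Open Scope ring_scope.

(** Write D for the double of H, q = chi a, and view D as generated by two
    subalgebras, the dual of H and H. A D-module is a space with an
    action [X] of H and an action [Y] of the dual of H, subject to one
    straightening rule for each of the generators g and x of H ([double_rep]).

    Let C be the commutative subalgebra of D spanned by the products of the
    functions on G (extended to H by killing x) and the elements of G. Its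
    characters are the pairs (lam, u) of a character lam of G and an element u
    of G, and every nonzero D-module contains an eigenvector for C
    ([weight_exists]). Three facts about these weights give the theorem.

    - The one-dimensional D-modules are the pairs (al, u) with al a = chi u
      ([one_dim_classification]): a one-dimensional module restricts to an
      algebra map on the dual of H, that is, to a group-like element of H, and
      those lie in G ([grouplike_in_G]); the equation is the straightening rule
      for x. Tensoring with such a module is pulling back along an automorphism
      of D ([tensor_one_dim]), which shifts the weights by (al, u); hence the
      tensor product with a simple module is simple, and tensoring is invertible.
    - The central group-like elements of D are the products of a character ga,
      seen in the dual of H, and an element g with ga a = chi g
      ([central_grouplike_pair], [central_grouplike_classification]). On a
      vector of weight (lam, u) such an element acts by ga u * lam g.
    - Hence they act trivially on vectors of weight (chi^-k, a^k)
      ([central_acts_trivially]), and a simple module with such a vector is a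
      module over the quotient, as the fixed vectors of a central element form
      a submodule ([bar_simple]).

    The module of weight (chi^-k, a^k) is one-dimensional exactly when
    q^(2k) = 1. If Phi is injective, such a module W must be trivial, since
    Phi sends both ([W], [1]) and ([1], [W]) to [W]; so q^(2k) = 1 forces
    chi^k = 1 and a^k = 1 ([Phi_injective_order]). Taking k = l / 2 shows that l
    is odd, and then k = l shows that the orders of chi and a, which are
    multiples of l, are equal to l.

    Conversely let l be odd and equal to the orders of chi and a. If U1 ⊗ V1 and
    U2 ⊗ V2 are isomorphic, the central group-like elements act on them by
    the scalars given by V1 and V2; comparing these scalars, and using that
    z |-> z^2 is injective on l-th roots of unity, gives V1 = V2 and then
    U1 = U2 ([Phi_injective_odd]). Given a simple module E with weight (lam, u),
    choose k with lam a * q^(2k) = chi u, which is possible because q^2 also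
    generates the l-th roots of unity; then the pair (lam chi^k, u a^-k) is a
    one-dimensional module V, and E ⊗ V^-1 has weight (chi^-k, a^k), hence is a
    module over the quotient ([Phi_surjective_odd]). *)

(** * Linear algebra *)

Section LinearAlgebra.
Variable K : fieldType.
Implicit Types U V W X : vectType K.

Lemma tliftP U V W (f : U -> V -> W) c s t :
  tlift f (c *: s + t) = c *: tlift f s + tlift f t.
Proof. exact: tlift_linear. Qed.

Lemma tliftD U V W (f : U -> V -> W) s t :
  tlift f (s + t) = tlift f s + tlift f t.
Proof. by rewrite -[s]scale1r tliftP !scale1r. Qed.

Lemma tlift_lin U V W X (g : U -> tens V W) (f : V -> W -> X) :
  linear g -> linear (fun u => tlift f (g u)).
Proof. by move=> hg c u v; rewrite hg tliftP. Qed.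

Lemma tlift_lincomb U V W (f g h : U -> V -> W) c t :
  (forall u v, f u v = c *: g u v + h u v) ->
  tlift f t = c *: tlift g t + tlift h t.
Proof.
move=> e; rewrite /tlift scaler_sumr -big_split /=; apply: eq_bigr => p _.
rewrite scaler_sumr -big_split /=; apply: eq_bigr => q _.
by rewrite e scalerDr !scalerA mulrC.
Qed.

Lemma tlift_comp_pure U V U' V' W (p : U -> U') (q : V -> V') (f : U' -> V' -> W) t :
  bilin f ->
  tlift f (tlift (fun u v => tpure (p u) (q v)) t) = tlift (fun u v => f (p u) (q v)) t.
Proof.
move=> bf; rewrite (tlift_comp _ _ (tlift_linear f)).
by apply: eq_tlift => u v; rewrite tlift_tpure.
Qed.

Lemma tens_eq U V W (f g : tens U V -> W) : linear f -> linear g ->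
  (forall u v, f (tpure u v) = g (tpure u v)) -> f =1 g.
Proof.
move=> lf lg e t; rewrite -[t]tlift_id !(tlift_comp _ _ lf, tlift_comp _ _ lg).
exact: eq_tlift.
Qed.

Lemma span_ind V (P : V -> Prop) (s : seq V) :
  P 0 -> (forall c u v, P u -> P v -> P (c *: u + v)) ->
  (forall u, u \in s -> P u) -> forall v, v \in <<s>>%VS -> P v.
Proof.
move=> P0 PD Ps v; rewrite span_def big_tnth => /memv_sumP[w hw ->].
elim/big_rec: _ => // j u _ Pu; have /vlineP[c ->] := hw j isT.
by apply: PD => //; apply: Ps; exact: mem_tnth.
Qed.

Lemma linear0f V W (f : V -> W) : linear f -> f 0 = 0.
Proof. by move=> lf; have := lf (-1) 0 0; rewrite scaleN1r addNr scaleN1r addNr. Qed.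

Lemma linearZf V W (f : V -> W) c v : linear f -> f (c *: v) = c *: f v.
Proof. by move=> lf; rewrite -[c *: v]addr0 lf linear0f // addr0. Qed.

Lemma linearDf V W (f : V -> W) u v : linear f -> f (u + v) = f u + f v.
Proof. by move=> lf; rewrite -[u]scale1r lf !scale1r. Qed.

Lemma linfunE V W (f : V -> W) : linear f -> linfun f =1 f.
Proof.
move=> lf v; pose L := GRing.isLinear.Build K V W *:%R f lf.
by pose g : {linear V -> W} := HB.pack f L; rewrite -[f]/(g : _ -> _) lfunE.
Qed.

Lemma dual_separates V (v w : V) :
  (forall f : 'Hom(V, K^o), f v = f w) -> v = w.
Proof.
move=> e; rewrite -[v]coord_vbasis_full -[w]coord_vbasis_full.
apply: eq_bigr => j _; congr (_ *: _).
have lc : linear (fun u : V => coord (vbasis {:V}) j u : K^o).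
  by move=> c u u'; rewrite linearP.
by have := e (linfun (fun u : V => coord (vbasis {:V}) j u : K^o)); rewrite !linfunE.
Qed.

Lemma linear_comp U V W (f : V -> W) (g : U -> V) :
  linear f -> linear g -> linear (fun u => f (g u)).
Proof. by move=> lf lg c u v; rewrite lg lf. Qed.

Lemma linear_sum_ord U V (f : U -> V) n (e : 'I_n -> U) :
  linear f -> f (\sum_j e j) = \sum_j f (e j).
Proof.
move=> lf; pose L := GRing.isLinear.Build K U V *:%R f lf.
by pose g : {linear U -> V} := HB.pack f L; rewrite -[f]/(g : _ -> _) linear_sum.
Qed.

Lemma functional_eq1 V (v : V) : v != 0 ->
  exists f : 'Hom(V, K^o), f v = 1 :> K.
Proof.
move=> v0; apply: contrapT => hf; move/negP: v0; apply; apply/eqP.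
apply: dual_separates => f; rewrite linear0; apply: contrapT => /eqP fv; apply: hf.
by exists ((f v : K)^-1 *: f); rewrite scale_lfunE; exact: mulVf.
Qed.

Lemma tpure_l U V (v : V) : linear (fun u : U => tpure u v).
Proof. by case: (tpure_bilin U V). Qed.

Lemma tpure_r U V (u : U) : linear (fun v : V => tpure u v).
Proof. by case: (tpure_bilin U V). Qed.

End LinearAlgebra.

Section FieldLemmas.
Variable K : fieldType.

Lemma odd_square_root (m : nat) (z w : K) : odd m -> z * z = w * w ->
  z ^+ m = 1 -> w ^+ m = 1 -> z = w.
Proof.
move=> om e zm wm; have e2 : z ^+ 2 = w ^+ 2 by rewrite !expr2.
have : z ^+ m * w = w ^+ m * z.
  rewrite -(odd_double_half m) om add1n -mul2n !exprS !exprM e2.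
  by rewrite [LHS]mulrC mulrA [RHS]mulrAC.
by rewrite zm wm !mul1r => ->.
Qed.

Lemma poly_eq_char0 (charK : [pchar K] =i pred0) (p q : {poly K}) :
  (forall c, p.[c] = q.[c]) -> p = q.
Proof.
move=> e; apply/eqP; rewrite -subr_eq0; apply/eqP.
pose s : seq K := [seq n%:R | n <- iota 0 (size (p - q))].
apply: (@roots_geq_poly_eq0 _ _ s).
- by apply/allP => c _; rewrite rootE hornerD hornerN e subrr.
- rewrite map_inj_in_uniq ?iota_uniq // => m n _ _.
  wlog mn : m n / (m <= n)%N => [hw e'|/eqP].
    by case: (leqP m n) => [/hw->//|/ltnW/hw->].
  rewrite eq_sym -subr_eq0 -natrB // (pcharf0P K).1 // subn_eq0 => nm.
  by apply/eqP; rewrite eqn_leq mn.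
- by rewrite size_map size_iota.
Qed.

End FieldLemmas.

Lemma unity_splits (K : closedFieldType) n : (0 < n)%N ->
  exists rs : seq K, 'X^n - 1 = \prod_(r <- rs) ('X - r%:P).
Proof.
move=> n0; have [rs e] := closed_field_poly_normal ('X^n - 1 : {poly K}).
by exists rs; rewrite {1}e (monicP _) ?scale1r // monicXnsubC.
Qed.

(** * Characters of a finite abelian group *)

Section FiniteAbelianGroup.
Variables (K : fieldType) (G : finGroupType).

Definition is_char (phi : G -> K) : Prop :=
  phi 1%g = 1 /\ forall g h, phi (g * h)%g = phi g * phi h.

Lemma char_V phi g : is_char phi -> phi g * phi g^-1%g = 1.
Proof. by case=> p1 pM; rewrite -pM mulgV p1. Qed.

Lemma char_neq0 phi g : is_char phi -> phi g != 0.
Proof.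
move=> hp; have := char_V g hp; apply: contra_eq_neq => ->.
by rewrite mul0r eq_sym oner_eq0.
Qed.

Lemma char_X phi g n : is_char phi -> phi (g ^+ n)%g = phi g ^+ n.
Proof.
case=> p1 pM; elim: n => [|n IH]; first by rewrite expg0 expr0.
by rewrite expgS exprS pM IH.
Qed.

Lemma charXn phi n : is_char phi -> is_char (fun g => phi g ^+ n).
Proof. by case=> p1 pM; split=> [|g h]; rewrite ?p1 ?expr1n // pM exprMn. Qed.

Lemma charM phi psi : is_char phi -> is_char psi -> is_char (fun g => phi g * psi g).
Proof.
case=> p1 pM [q1 qM]; split=> [|g h]; first by rewrite p1 q1 mulr1.
by rewrite pM qM mulrACA.
Qed.

(** The factors f - r, applied in turn to v, end at 0; the last nonzero vector
    on the way is an eigenvector. *)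
Lemma finite_order_eigenvector (V : vectType K) (f : 'End(V)) n (rs : seq K)
    (W : {vspace V}) v :
  'X^n - 1 = \prod_(r <- rs) ('X - r%:P) -> iter n f v = v ->
  (forall w, w \in W -> f w \in W) -> v \in W -> v != 0 ->
  exists r w, [/\ w \in W, w != 0 & f w = r *: w].
Proof.
move=> prs fn fW vW v0.
(* [ev N p] is the value at v of the polynomial p in f, if p has size at most N. *)
pose ev N (p : {poly K}) := \sum_(j < N) p`_j *: iter j f v.
have evX N r (q : {poly K}) : (size q <= N)%N ->
    ev N.+1 (('X - r%:P) * q) = f (ev N q) - r *: ev N q.
  move=> sq; rewrite {1}/ev.
  transitivity (\sum_(j < N.+1) ('X * q)`_j *: iter j f v
      - \sum_(j < N.+1) (r * q`_j) *: iter j f v).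
    rewrite -sumrB; apply: eq_bigr => j _.
    by rewrite mulrBl coefB coefCM scalerBl.
  congr (_ - _).
    rewrite big_ord_recl coefXM scale0r add0r /ev linear_sum; apply: eq_bigr => j _.
    by rewrite coefXM linearZ.
  rewrite big_ord_recr /= nth_default // mulr0 scale0r addr0 scaler_sumr.
  by apply: eq_bigr => j _; rewrite scalerA.
have key (s : seq K) : ev (size s).+1 (\prod_(r <- s) ('X - r%:P))
    = foldr (fun r w => f w - r *: w) v s.
  elim: s => [|r s IH]; first by rewrite big_nil /ev big_ord1 coef1 scale1r.
  by rewrite big_cons evX ?size_prod_XsubC // IH.
have srs : size rs = n.
  have := congr1 (fun p : {poly K} => size p) prs; rewrite size_prod_XsubC.
  case: n {fn prs} => [|n]; first by rewrite expr0 subrr size_poly0.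
  by rewrite size_XnsubC // => -[].
have ev0 : foldr (fun r w => f w - r *: w) v rs = 0.
  rewrite -key srs -prs /ev; case: (posnP n) => [n0|n0].
    by rewrite n0 expr0 subrr big1 // => j _; rewrite coef0 scale0r.
  transitivity (\sum_(j < n.+1) (('X^n)`_j *: iter j f v - (1 : {poly K})`_j *: iter j f v)).
    by apply: eq_bigr => j _; rewrite coefB scalerBl.
  rewrite sumrB big_ord_recr /= coefXn eqxx scale1r big1 ?add0r => [|j _]; last first.
    by rewrite coefXn ltn_eqF // scale0r.
  rewrite big_ord_recl coef1 scale1r big1 ?addr0 => [|j _]; last by rewrite coef1 scale0r.
  by rewrite fn subrr.
elim: rs {prs key srs} ev0 => [|r s IH] /=; first by move=> v00; rewrite v00 eqxx in v0.
set w := foldr _ v s => e; have [w0|w0] := eqVneq w 0; first exact: IH.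
exists r, w; split=> //; last by apply/eqP; rewrite -subr_eq0 e.
rewrite /w; elim: (s) => //= r' s' IHs.
by rewrite memvB ?memvZ ?fW.
Qed.

Hypothesis abG : abelian [set: G].
Hypothesis splits :
  forall n, (0 < n)%N -> exists rs : seq K, 'X^n - 1 = \prod_(r <- rs) ('X - r%:P).

(** The eigenspaces of one element of G are stable under the others, so they can
    be cut down one element at a time. *)
Lemma common_eigenvector (V : vectType K) (rho : G -> 'End(V)) (W : {vspace V}) :
  (forall v, rho 1%g v = v) -> (forall g h v, rho (g * h)%g v = rho g (rho h v)) ->
  (forall g w, w \in W -> rho g w \in W) -> (W != 0)%VS ->
  exists v lam, [/\ v \in W, v != 0, is_char lam & forall g, rho g v = lam g *: v].
Proof.
move=> r1 rM rW W0.
have [W' [W'W W'0 [_ W'e]]] : exists W' : {vspace V}, [/\ (W' <= W)%VS, (W' != 0)%VS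
    & (forall g w, w \in W' -> rho g w \in W') /\
      forall g, g \in enum G -> exists r, forall w, w \in W' -> rho g w = r *: w].
  elim: (enum G) => [|g s [W' [W'W W'0 [st ee]]]]; first by exists W.
  have gn v : iter #[g]%g (rho g) v = v.
    rewrite -[RHS]r1 -(expg_order g); elim: #[g]%g => [|n IH]; first by rewrite expg0 r1.
    by rewrite iterS IH expgS rM.
  have [rs ers] := splits (order_gt0 g).
  have v0 : vpick W' != 0 by rewrite vpick0.
  have [r [w [wW w0 ew]]] := finite_order_eigenvector ers (gn _) (st g) (memv_pick W') v0.
  have memE (u : V) : (u \in lker (rho g - r *: \1)%VF) = (rho g u == r *: u).
    by rewrite memv_ker add_lfunE opp_lfunE scale_lfunE id_lfunE subr_eq0.
  exists (W' :&: lker (rho g - r *: \1)%VF)%VS; split.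
  - exact: subv_trans (capvSl _ _) W'W.
  - apply: contraNneq w0 => e; rewrite -memv0 -e memv_cap wW memE; exact/eqP.
  - split=> [h u|h].
      rewrite !memv_cap !memE => /andP[uW /eqP ue]; rewrite st //=.
      have gh : (g * h = h * g)%g by apply: (centsP abG); rewrite inE.
      by rewrite -rM gh rM ue linearZ.
    rewrite inE => /predU1P[->|hs].
      by exists r => u; rewrite memv_cap memE => /andP[_ /eqP].
    have [r' er'] := ee h hs; exists r' => u.
    by rewrite memv_cap => /andP[uW _]; exact: er'.
have ex g : exists r, forall w, w \in W' -> rho g w = r *: w.
  by apply: W'e; rewrite mem_enum.
pose lam g := projT1 (cid (ex g)).
have lamE g w : w \in W' -> rho g w = lam g *: w by rewrite /lam; case: cid => /= ? h; exact: h.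
have vW := memv_pick W'; have v0 : vpick W' != 0 by rewrite vpick0.
have scal c d : c *: vpick W' = d *: vpick W' -> c = d.
  by move/eqP; rewrite -subr_eq0 -scalerBl scaler_eq0 (negPf v0) orbF subr_eq0 => /eqP.
exists (vpick W'), lam; split=> // [||g]; last exact: lamE.
- exact: (subvP W'W).
- split=> [|g h]; apply: scal; first by rewrite -lamE // r1 scale1r.
  by rewrite -lamE // rM (lamE h) // linearZ /= (lamE g) // scalerA mulrC.
Qed.

Hypothesis charK : [pchar K] =i pred0.

(** An eigenvector in the image of w - 1 on the regular representation cannot
   be fixed by w, because the sum of the powers of w kills that image. *)
Lemma char_separation (w : G) : (forall ga, is_char ga -> ga w = 1) -> w = 1%g.
Proof.
move=> hw; apply: contrapT => /eqP w1.
pose V : vectType K := {ffun G -> K^o}.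
pose r (g : G) (phi : V) : V := [ffun h => phi (h * g)%g].
have lr g : linear (r g) by move=> c p q; apply/ffunP => h; rewrite !ffunE.
pose rho g : 'End(V) := linfun (r g).
have rE g p h : rho g p h = p (h * g)%g by rewrite linfunE // ffunE.
have rM g h p : rho (g * h)%g p = rho g (rho h p).
  by apply/ffunP => k; rewrite !rE mulgA.
pose Z : 'End(V) := (rho w - \1)%VF.
have ZE p h : Z p h = p (h * w)%g - p h.
  by rewrite add_lfunE opp_lfunE id_lfunE !ffunE rE.
have [||||phi [ga [/memv_imgP[psi _ phiE] phi0 hga gaE]]] := @common_eigenvector V rho (limg Z).
- by move=> p; apply/ffunP => h; rewrite rE mulg1.
- exact: rM.
- move=> g _ /memv_imgP[p _ ->].
  have -> : rho g (Z p) = Z (rho g p).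
    apply/ffunP => h; rewrite rE !ZE !rE -!mulgA.
    by rewrite (_ : g * w = w * g)%g //; apply: (centsP abG); rewrite inE.
  by rewrite memv_img ?memvf.
- pose d : V := [ffun h => (h == 1%g)%:R : K^o].
  apply: contraNneq w1 => e.
  have : Z d \in limg Z by rewrite memv_img ?memvf.
  rewrite e memv0 => /eqP/ffunP/(_ 1%g); rewrite ZE !ffunE mul1g eqxx.
  by case: (w == 1)%g => // /eqP; rewrite sub0r oppr_eq0 oner_eq0.
have fixw h : phi (h * w)%g = phi h by rewrite -rE gaE hw // scale1r.
have zero h : phi h = 0.
  have fixn n : phi (h * w ^+ n)%g = phi h.
    elim: n => [|n IH]; first by rewrite mulg1.
    by rewrite expgSr mulgA fixw.
  have tel n : \sum_(j < n) phi (h * w ^+ j)%g = psi (h * w ^+ n)%g - psi h.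
    elim: n => [|n IH]; first by rewrite big_ord0 mulg1 subrr.
    by rewrite big_ord_recr IH /= phiE ZE expgSr mulgA addrC addrA subrK.
  have := tel #[w]%g; rewrite expg_order mulg1 subrr.
  under eq_bigr => j _ do rewrite fixn.
  rewrite sumr_const card_ord -scaler_nat => /eqP; rewrite scaler_eq0.
  by rewrite ((pcharf0P K).1 charK) -leqn0 leqNgt order_gt0 => /eqP.
by move/eqP: phi0; apply; apply/ffunP => h; rewrite zero ffunE.
Qed.

End FiniteAbelianGroup.

Section DatumAlgebra.
Variables (K : fieldType) (G : finGroupType).
Hypothesis charK : [pchar K] =i pred0.
Hypothesis abG : abelian [set: G].
Variables (chi : G -> K) (a : G) (l : nat).
Hypothesis chi1 : chi 1%g = 1.
Hypothesis chiM : forall g h : G, chi (g * h)%g = chi g * chi h.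
Hypothesis hl : l.-primitive_root (chi a).
Variables (H : hopfAlg K) (i : G -> H) (x : H).
Hypothesis hH : is_hopf_of_datum chi a l i x.

Local Notation eps := (counit H).
Local Notation S := (antipode H).

Lemma mulCG (g h : G) : (g * h = h * g)%g.
Proof. by apply: (centsP abG); rewrite inE. Qed.

Lemma i1 : i 1%g = 1. Proof. by case: hH => -[]. Qed.
Lemma iM g h : i (g * h)%g = i g * i h. Proof. by case: hH => -[]. Qed.
Lemma xl0 : x ^+ l = 0. Proof. by case: hH => -[]. Qed.
Lemma x_iE g : x * i g = chi g *: (i g * x). Proof. by case: hH => -[]. Qed.
Lemma comul_x : comul H x = tpure x (i a) + tpure 1 x. Proof. by case: hH. Qed.
Lemma comul_i g : comul H (i g) = tpure (i g) (i g). Proof. by case: hH. Qed.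

Lemma iC g h : i g * i h = i h * i g. Proof. by rewrite -!iM mulCG. Qed.
Lemma iVi g : i g^-1%g * i g = 1. Proof. by rewrite -iM mulVg i1. Qed.
Lemma iiV g : i g * i g^-1%g = 1. Proof. by rewrite -iM mulgV i1. Qed.

(** Maps out of H are determined on G and x: both agree with the unique map
    given by the presentation for the images of the generators. *)
Lemma presentation_ext (B : algType K) (f f' : {lrmorphism H -> B}) :
  (forall g, f (i g) = f' (i g)) -> f x = f' x -> f =1 f'.
Proof.
move=> fi fx; case: hH => hr hu _ _.
have rf : datum_rel chi l (fun g => f (i g)) (f x).
  split=> [|g h||g]; first by rewrite i1 rmorph1.
  - by rewrite iM rmorphM.
  - by rewrite -rmorphXn xl0 rmorph0.
  by rewrite -!rmorphM x_iE; exact: (linearZ_LR f).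
have [f0 [_ _ u0]] := hu B _ _ rf.
by move=> h; rewrite (u0 f) // (u0 f').
Qed.

Let gens : seq H := x :: [seq i g | g <- enum G].

(** The presentation gives a map of H into the subalgebra generated by G and x;
    followed by the inclusion it fixes the generators, hence is the identity. *)
Lemma generated : agenv <<gens>> = fullv.
Proof.
set A := agenv_aspace <<gens>>.
have gA (u : H) : u \in gens -> u \in A.
  by move=> hu; apply: (subvP (sub_agenv _)); exact: memv_span.
have one : algid A = 1 by apply/eqP; rewrite algid_eq1; rewrite memvE; exact: sub1_agenv.
have iA g : i g \in A by apply: gA; rewrite inE map_f ?orbT // mem_enum.
have xA : x \in A by apply: gA; rewrite inE eqxx.
have rA : datum_rel chi l (fun g => Subvs (iA g) : subvs_of A) (Subvs xA).
  split=> [|g h||g]; apply: val_inj => /=.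
  - by rewrite i1 one.
  - by rewrite iM.
  - rewrite -[RHS]xl0; elim: l => [|n IH]; first by rewrite !expr0 /= one.
    by rewrite !exprS /= IH.
  by rewrite x_iE.
have [_ hu _ _] := hH; have [f [fi fx _]] := hu _ _ _ rA.
pose F (h : H) : H := vsval (f h).
have F1 : GRing.monoid_morphism F.
  by split=> [|u v]; rewrite /F ?rmorph1 ?rmorphM /= ?one.
have Flin : linear F by move=> c u v; rewrite /F !linearP.
pose L := GRing.isLinear.Build K H H *:%R F Flin.
pose M := GRing.isMonoidMorphism.Build H H F F1.
pose F' : {lrmorphism H -> H} := HB.pack F L M.
have FE : F' =1 (idfun : {lrmorphism H -> H}).
  by apply: presentation_ext => [g|] /=; rewrite /F ?fi ?fx.
by apply/vspaceP => h; rewrite memvf -[h](FE h) subvsP.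
Qed.

(** The form of induction suited to Sweedler sums: the coproducts of [i g * h] and
    [x * h] are explicit in that of h. *)
Lemma left_ind (P : H -> Prop) :
  (forall c h k, P h -> P k -> P (c *: h + k)) -> P 1 ->
  (forall g h, P h -> P (i g * h)) -> (forall h, P h -> P (x * h)) ->
  forall h, P h.
Proof.
move=> Plin P1 Pi Px h.
have P0 : P 0 by have := Plin (-1) _ _ P1 P1; rewrite scaleN1r addNr.
have : h \in agenv <<gens>> by rewrite generated memvf.
move=> /memv_sumP[w hw ->]; elim/big_rec: _ => // n u _ Pu.
rewrite -[w n]scale1r; apply: (Plin) => //; have := hw n isT.
elim: (n : nat) (w n) => [|m IH] {Pu}u0.
  by rewrite expv0 => /vlineP[c ->]; rewrite -[c *: 1]addr0; exact: Plin.
rewrite expvSl [@prodv _ _]unlock; apply: span_ind => //.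
move=> _ /allpairsP[[v t] /= [/vbasis_mem hv /vbasis_mem/IH ht ->]].
apply: (@span_ind _ _ (fun v => P (v * t)) gens _ _ _ v hv); first by rewrite mul0r.
  by move=> c p q Pp Pq; rewrite mulrDl -scalerAl; exact: Plin.
move=> p; rewrite inE => /predU1P[->|/mapP[g _ ->]]; [exact: Px|exact: Pi].
Qed.

Lemma linear_ext (V : lmodType K) (f f' : H -> V) : linear f -> linear f' ->
  f 1 = f' 1 -> (forall g h, f h = f' h -> f (i g * h) = f' (i g * h)) ->
  (forall h, f h = f' h -> f (x * h) = f' (x * h)) -> f =1 f'.
Proof.
move=> lf lf' e1 ei ex; apply: left_ind => // c h k eh ek.
by rewrite lf lf' eh ek.
Qed.

(** * Sweedler sums *)

Definition trilin (V : vectType K) (F : H -> H -> H -> V) : Prop :=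
  [/\ forall v w, linear (fun u => F u v w),
      forall u w, linear (fun v => F u v w) & forall u v, linear (F u v)].

(** [sw2 F h] is the Sweedler sum of the F h_(1) h_(2), and [sw3 F h] that of
    the F h_(1) h_(2) h_(3), bracketed as in the product of the double. *)
Definition sw2 (V : vectType K) (F : H -> H -> V) h : V := tlift F (comul H h).

Definition sw3 (V : vectType K) (F : H -> H -> H -> V) h : V :=
  sw2 (fun h12 h3 => sw2 (fun h1 h2 => F h1 h2 h3) h12) h.

Lemma sw2_lin (V : vectType K) (F : H -> H -> V) : linear (sw2 F).
Proof. by move=> c h k; rewrite /sw2 linearP tliftP. Qed.

Lemma eq_sw2 (V : vectType K) (F F' : H -> H -> V) h :
  (forall u v, F u v = F' u v) -> sw2 F h = sw2 F' h.
Proof. exact: eq_tlift. Qed.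

Lemma sw2_comp (V W : vectType K) (g : V -> W) (F : H -> H -> V) h : linear g ->
  g (sw2 F h) = sw2 (fun u v => g (F u v)) h.
Proof. exact: tlift_comp. Qed.

Lemma sw2_lincomb (V : vectType K) (F F1 F2 : H -> H -> V) c h :
  (forall u v, F u v = c *: F1 u v + F2 u v) ->
  sw2 F h = c *: sw2 F1 h + sw2 F2 h.
Proof. exact: tlift_lincomb. Qed.

Lemma sw2_bilin (V : vectType K) (F : H -> H -> H -> V) : trilin F ->
  bilin (fun h12 h3 => sw2 (fun h1 h2 => F h1 h2 h3) h12).
Proof.
move=> [_ _ F3]; split=> [w|u c v w]; first exact: sw2_lin.
by apply: sw2_lincomb => p q; rewrite F3.
Qed.

Lemma sw2_pure (V : vectType K) (F : H -> H -> V) h u v :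
  bilin F -> comul H h = tpure u v -> sw2 F h = F u v.
Proof. by rewrite /sw2 => bF ->; rewrite tlift_tpure. Qed.

Lemma sw2_1 (V : vectType K) (F : H -> H -> V) : bilin F -> sw2 F 1 = F 1 1.
Proof. by move=> bF; apply: sw2_pure => //; exact: comul1. Qed.

Lemma sw2_i (V : vectType K) (F : H -> H -> V) g : bilin F -> sw2 F (i g) = F (i g) (i g).
Proof. by move=> bF; apply: sw2_pure => //; exact: comul_i. Qed.

Lemma sw2_x (V : vectType K) (F : H -> H -> V) : bilin F ->
  sw2 F x = F x (i a) + F 1 x.
Proof. by move=> bF; rewrite /sw2 comul_x tliftD !tlift_tpure. Qed.

Lemma bilin_mul (V : vectType K) (F : H -> H -> V) p q : bilin F ->
  bilin (fun u v => F (p * u) (q * v)).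
Proof.
by move=> [Fl Fr]; split=> [w|w] c u v;
   rewrite mulrDr -scalerAr ?(Fl (q * w)) ?(Fr (p * w)).
Qed.

Lemma sw2M (V : vectType K) (F : H -> H -> V) h k : bilin F ->
  sw2 F (h * k) = sw2 (fun h1 h2 => sw2 (fun k1 k2 => F (h1 * k1) (h2 * k2)) k) h.
Proof.
move=> bF; rewrite /sw2 comulM (tlift_comp _ _ (tlift_linear F)).
by apply: eq_tlift => h1 h2; rewrite tlift_comp_pure.
Qed.

Lemma bilin_sw2_mul (V : vectType K) (F : H -> H -> V) k : bilin F ->
  bilin (fun h1 h2 => sw2 (fun k1 k2 => F (h1 * k1) (h2 * k2)) k).
Proof.
move=> [Fl Fr]; split=> [w|w] c u v; apply: sw2_lincomb => p q;
  by rewrite mulrDl -scalerAl ?(Fl (w * q)) ?(Fr (w * p)).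
Qed.

Lemma sw2_iM (V : vectType K) (F : H -> H -> V) g h : bilin F ->
  sw2 F (i g * h) = sw2 (fun h1 h2 => F (i g * h1) (i g * h2)) h.
Proof. by move=> bF; rewrite sw2M // sw2_i //; exact: bilin_sw2_mul. Qed.

Lemma sw2_xM (V : vectType K) (F : H -> H -> V) h : bilin F ->
  sw2 F (x * h) = sw2 (fun h1 h2 => F (x * h1) (i a * h2)) h
                + sw2 (fun h1 h2 => F h1 (x * h2)) h.
Proof.
move=> bF; rewrite sw2M // sw2_x; last exact: bilin_sw2_mul.
by congr (_ + _); apply: eq_sw2 => u v; rewrite mul1r.
Qed.

Lemma sw2D (V : vectType K) (F F1 F2 : H -> H -> V) h :
  (forall u v, F u v = F1 u v + F2 u v) -> sw2 F h = sw2 F1 h + sw2 F2 h.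
Proof.
by move=> e; rewrite -[sw2 F1 h]scale1r; apply: sw2_lincomb => u v; rewrite scale1r.
Qed.

Lemma sw3_lin (V : vectType K) (F : H -> H -> H -> V) : linear (sw3 F).
Proof. exact: sw2_lin. Qed.

Lemma eq_sw3 (V : vectType K) (F F' : H -> H -> H -> V) h :
  (forall u v w, F u v w = F' u v w) -> sw3 F h = sw3 F' h.
Proof. by move=> e; do 2!apply: eq_sw2 => ? ?; exact: e. Qed.

Lemma sw3_comp (V W : vectType K) (g : V -> W) (F : H -> H -> H -> V) h : linear g ->
  g (sw3 F h) = sw3 (fun u v w => g (F u v w)) h.
Proof. by move=> lg; rewrite /sw3 sw2_comp //; apply: eq_sw2 => u v; rewrite sw2_comp. Qed.

Lemma sw3_1 (V : vectType K) (F : H -> H -> H -> V) : trilin F -> sw3 F 1 = F 1 1 1.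
Proof.
move=> tF; rewrite /sw3 sw2_1; last exact: sw2_bilin.
by rewrite sw2_1 //; case: tF => F1 F2 F3; split=> [w|w]; [exact: F1|exact: F2].
Qed.

Lemma trilin_bilin (V : vectType K) (F : H -> H -> H -> V) w :
  trilin F -> bilin (fun u v => F u v w).
Proof. by case=> F1 F2 _; split=> t; [exact: F1|exact: F2]. Qed.

Lemma sw3_iM (V : vectType K) (F : H -> H -> H -> V) g h : trilin F ->
  sw3 F (i g * h) = sw3 (fun u v w => F (i g * u) (i g * v) (i g * w)) h.
Proof.
move=> tF; rewrite /sw3 sw2_iM; last exact: sw2_bilin.
by apply: eq_sw2 => u v; rewrite sw2_iM //; exact: trilin_bilin.
Qed.

Lemma sw3_xM (V : vectType K) (F : H -> H -> H -> V) h : trilin F ->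
  sw3 F (x * h) = sw3 (fun u v w => F (x * u) (i a * v) (i a * w)) h
                + sw3 (fun u v w => F u (x * v) (i a * w)) h
                + sw3 (fun u v w => F u v (x * w)) h.
Proof.
move=> tF; rewrite /sw3 sw2_xM; last exact: sw2_bilin.
congr (_ + _); apply: sw2D => u v.
by rewrite sw2_xM //; exact: trilin_bilin.
Qed.

Lemma sw2_assoc (V : vectType K) (F : H -> H -> H -> V) h : trilin F ->
  sw2 (fun u v => sw2 (F u) v) h = sw3 F h.
Proof.
move=> [F1 F2 F3].
pose R (s : tens H (tens H H)) := tlift (fun u t => tlift (F u) t) s.
have bR : bilin (fun u t => tlift (F u) t).
  split=> [t c u v|u c s t]; last exact: tliftP.
  by apply: tlift_lincomb => p q; rewrite F1.
have bF u : bilin (F u) by split.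
have := congr1 R (comulA h).
rewrite /R !(tlift_comp _ _ (tlift_linear _)) => /esym e.
transitivity (tlift (fun u v => R (tpure u (comul H v))) (comul H h)).
  by apply: eq_tlift => u v; rewrite /R tlift_tpure.
rewrite /R e; apply: eq_tlift => u v.
rewrite (tlift_comp _ _ (tlift_linear _)).
by apply: eq_tlift => p q; rewrite !tlift_tpure.
Qed.

(** * The antipode and its inverse *)

(** The identity of H is invertible for convolution, with inverse the antipode. *)
Lemma convolution_cancel (W W' : H -> H) : linear W -> linear W' ->
  (forall h, sw2 (fun u v => W u * v) h = sw2 (fun u v => W' u * v) h) -> W =1 W'.
Proof.
move=> lW lW' e.
have key (Z : H -> H) : linear Z -> forall h,
  Z h = sw2 (fun h12 w => sw2 (fun u v => Z u * v) h12 * S w) h.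
  move=> lZ h; have tZ : trilin (fun u v w => Z u * v * S w).
    by split=> p q c u v; rewrite ?linearP ?lZ ?(mulrDl, mulrDr) ?(mulrDl, mulrDr)
      -?scalerAl -?scalerAr -?scalerAl.
  transitivity (sw3 (fun u v w => Z u * v * S w) h); last first.
    apply: eq_sw2 => u v; rewrite (sw2_comp (g := fun t => t * S v)) //.
    by move=> c p q; rewrite mulrDl -scalerAl.
  rewrite -sw2_assoc // -{1}[h]counitr (tlift_comp _ _ lZ); apply: eq_tlift => u v.
  transitivity (Z u * sw2 (fun p q => p * S q) v).
    by rewrite /sw2 antipoder linearZf // -mulr_algr.
  rewrite (sw2_comp (g := fun t => Z u * t)).
    by apply: eq_sw2 => p q; rewrite mulrA.
  by move=> c p q; rewrite mulrDr -scalerAr.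
move=> h; rewrite (key W) // (key W') //.
by apply: eq_sw2 => u v; rewrite e.
Qed.

Lemma sw2_antipode h : sw2 (fun u v => S u * v) h = (eps h : K)%:A.
Proof. exact: antipodel. Qed.

Lemma bilin_conv (W : H -> H) : linear W -> bilin (fun u v => W u * v).
Proof.
move=> lW; split=> p c u v; first by rewrite lW mulrDl -scalerAl.
by rewrite mulrDr -scalerAr.
Qed.

Lemma eps_i g : eps (i g) = 1.
Proof.
have /(congr1 (fun h => h * i g^-1%g)) : (eps (i g) : K) *: i g = i g.
  have := counitl (i g); rewrite comul_i tlift_tpure //.
  by split=> p c u v; rewrite ?linearP ?scalerDl ?scalerDr ?scalerA // mulrC.
rewrite -scalerAl iiV => /(congr1 (counit H)).
by rewrite linearZ /= counit1 => e; rewrite -[LHS]mulr1.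
Qed.

Lemma eps_x : eps x = 0.
Proof.
have := counitl x; rewrite comul_x tliftD.
have b : bilin (fun u v : H => (eps u : K) *: v).
  by split=> p c u v; rewrite ?linearP ?scalerDl ?scalerDr ?scalerA // mulrC.
rewrite !tlift_tpure // counit1 scale1r => /eqP; rewrite -subr_eq0 addrK => /eqP e.
have /(congr1 (counit H)) : (eps x : K) *: (i a * i a^-1%g) = 0.
  by rewrite scalerAl e mul0r.
by rewrite iiV linearZ /= counit1 linear0 => {}e; rewrite -[LHS]mulr1.
Qed.

Lemma S1 : S 1 = 1.
Proof.
have := sw2_antipode 1; rewrite sw2_1; last by apply: bilin_conv => c u v; rewrite linearP.
by rewrite mulr1 counit1 scale1r.
Qed.

Lemma eps_iM g h : (eps (i g * h) : K) = eps h.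
Proof. by rewrite counitM eps_i mul1r. Qed.

Lemma eps_xM h : (eps (x * h) : K) = 0.
Proof. by rewrite counitM eps_x mul0r. Qed.

Lemma S_lin : linear S. Proof. by move=> c u v; rewrite linearP. Qed.

Lemma linear_mull (k : H) : linear (fun h => k * h).
Proof. by move=> c u v; rewrite mulrDr -scalerAr. Qed.

Lemma linear_mulr (k : H) : linear (fun h => h * k).
Proof. by move=> c u v; rewrite mulrDl -scalerAl. Qed.

(** Both [S] and h |-> S (i g * h) * i g are convolution inverses of the identity. *)
Lemma S_iM g h : S (i g * h) = S h * i g^-1%g.
Proof.
suff e : S (i g * h) * i g = S h by rewrite -e -mulrA iiV mulr1.
move: h; apply: convolution_cancel; last move=> h.
- exact: linear_comp (linear_mulr _) (linear_comp S_lin (linear_mull _)).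
- exact: S_lin.
rewrite sw2_antipode -(eps_iM g) -sw2_antipode sw2_iM; last exact: bilin_conv S_lin.
by apply: eq_sw2 => u v; rewrite mulrA.
Qed.

(** The sum of the S (y_(1)) * y_(2) vanishes at y = x * h; with the coproduct of
    x * h this says that h |-> S (x * h) * i a and h |-> - S h * x have the same
    convolution product with the identity. *)
Lemma S_xM h : S (x * h) = - (S h * x * i a^-1%g).
Proof.
suff e : S (x * h) * i a = - (S h * x).
  by rewrite -mulNr -e -mulrA iiV mulr1.
move: h; apply: convolution_cancel; last move=> h.
- exact: linear_comp (linear_mulr _) (linear_comp S_lin (linear_mull _)).
- by move=> c u v; rewrite linearP mulrDl -scalerAl opprD scalerN.
have := sw2_antipode (x * h); rewrite sw2_xM; last exact: bilin_conv S_lin.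
rewrite eps_xM scale0r => /eqP; rewrite addr_eq0 => /eqP e.
transitivity (sw2 (fun u v => S (x * u) * (i a * v)) h).
  by apply: eq_sw2 => u v; rewrite mulrA.
rewrite e (sw2_comp (g := -%R)); last by move=> c u v; rewrite opprD scalerN.
by apply: eq_sw2 => u v; rewrite mulNr mulrA.
Qed.

Lemma SM h k : S (h * k) = S k * S h.
Proof.
move: h; apply: linear_ext.
- exact: linear_comp S_lin (linear_mulr k).
- exact: linear_comp (linear_mull _) S_lin.
- by rewrite mul1r S1 mulr1.
- by move=> g h e; rewrite -mulrA !S_iM e mulrA.
- by move=> h e; rewrite -mulrA !S_xM e mulrN !mulrA.
Qed.

Lemma S_i g : S (i g) = i g^-1%g.
Proof. by rewrite -[i g]mulr1 S_iM S1 mul1r. Qed.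

Lemma S_x : S x = - (x * i a^-1%g).
Proof. by rewrite -[x in LHS]mulr1 S_xM S1 mul1r. Qed.

Lemma S_Tx : S (- (i a^-1%g * x)) = x.
Proof.
rewrite (raddfN S) /= SM S_i S_x invgK.
by rewrite mulNr opprK -mulrA iVi mulr1.
Qed.

(** The image of [S] contains 1 and is stable under multiplication by g = S g^-1 and
    by x, as [S] reverses products. Surjectivity makes the linear inverse [T] of [S] a
    genuine inverse, which the product of the double uses. *)
Lemma S_surj h : exists k, S k = h.
Proof.
move: h; apply: left_ind => [c h1 h2 [k1 <-] [k2 <-]||g _ [k <-]|_ [k <-]].
- by exists (c *: k1 + k2); rewrite linearP.
- by exists 1; exact: S1.
- by exists (k * i g^-1%g); rewrite SM S_i invgK.
- by exists (k * - (i a^-1%g * x)); rewrite SM S_Tx.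
Qed.

Lemma S_ker0 : lker S == 0%VS.
Proof.
have e : limg S = fullv.
  apply/vspaceP => h; rewrite memvf; have [k <-] := S_surj h.
  by rewrite memv_img ?memvf.
by have := limg_ker_dim S fullv; rewrite capfv e -[X in _ = X]add0n => /addIn/eqP; rewrite dimv_eq0.
Qed.

Local Notation T := ((antipode H)^-1)%VF.

Lemma TK : cancel S T. Proof. exact: lker0_lfunK S_ker0. Qed.
Lemma TKV : cancel T S.
Proof. by move=> h; have [k <-] := S_surj h; rewrite TK. Qed.

Lemma T_lin : linear T. Proof. by move=> c u v; rewrite linearP. Qed.
Lemma T1 : T 1 = 1. Proof. by rewrite -{1}S1 TK. Qed.
Lemma TM h k : T (h * k) = T k * T h.
Proof. by apply: (can_inj TK); rewrite SM !TKV. Qed.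
Lemma T_i g : T (i g) = i g^-1%g.
Proof. by apply: (can_inj TK); rewrite TKV S_i invgK. Qed.
Lemma T_x : T x = - (i a^-1%g * x).
Proof. by apply: (can_inj TK); rewrite TKV S_Tx. Qed.

(** * Linear functionals on H *)

Local Notation D := (dual H).

Lemma hit_lE b (f : D) c : hit_l b f c = f (c * b).
Proof. by rewrite linfunE //; exact: linear_comp (linearP f) (linear_mulr b). Qed.

Lemma hit_rE (f : D) b c : hit_r f b c = f (b * c).
Proof. by rewrite linfunE //; exact: linear_comp (linearP f) (linear_mull b). Qed.

Lemma dual_linP (f : D) c u v : (f (c *: u + v) : K) = c * (f u : K) + (f v : K).
Proof. by rewrite linearP. Qed.

Lemma bilin_fg (f g : D) : bilin (fun u v => (f u : K) * (g v : K) : K^o).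
Proof.
split=> p c u v; first by rewrite dual_linP mulrDl -mulrA.
by rewrite dual_linP mulrDr mulrCA.
Qed.

Lemma dual_mulE (f g : D) c : dual_mul f g c = sw2 (fun u v => (f u : K) * (g v : K) : K^o) c.
Proof. by rewrite linfunE //; exact: sw2_lin. Qed.

Lemma l_gt0 : (0 < l)%N.
Proof. exact: prim_order_gt0 hl. Qed.

(** * Functions on G as functionals on H *)

(** H acts on the group algebra of G through h |-> h with x replaced by 0; the
    functional [delta w h] is the coefficient of w in the image of 1. *)
Lemma coefficient_exists : exists delta : G -> D,
  [/\ forall w, delta w 1 = (w == 1%g)%:R :> K,
      forall w g h, delta w (i g * h) = delta (g^-1 * w)%g h :> K
    & forall w h, delta w (x * h) = 0 :> K].
Proof.
have cG : #|G|.-1.+1 = #|G| by rewrite prednK // -cardsT cardG_gt0.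
pose r (p : 'I_#|G|.-1.+1) : G := enum_val (cast_ord cG p).
pose s (g : G) : 'I_#|G|.-1.+1 := cast_ord (esym cG) (enum_rank g).
have rs g : r (s g) = g by rewrite /r /s cast_ordKV enum_rankK.
have sr p : s (r p) = p by rewrite /r /s enum_valK cast_ordK.
pose rho (g : G) : 'M[K]_(#|G|.-1.+1) := \matrix_(p, q) (r p == g * r q)%g%:R.
have rhoE g (B : 'M[K]_(#|G|.-1.+1)) p q : (rho g * B) p q = B (s (g^-1 * r p)%g) q.
  rewrite mxE (bigD1 (s (g^-1 * r p)%g)) //= big1 => [|k kp].
    by rewrite mxE rs mulKVg eqxx mul1r addr0.
  rewrite mxE (_ : _ == _ = false) ?mul0r //; apply: contraNF kp => /eqP ->.
  by rewrite mulKg sr.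
have rr : datum_rel chi l rho 0.
  split=> [|g h||g].
  - apply/matrixP => p q; rewrite !mxE mul1g.
    by rewrite -(inj_eq (can_inj rs)) ?sr // (inj_eq (can_inj sr)).
  - by apply/matrixP => p q; rewrite rhoE !mxE rs -[in RHS](inj_eq (mulgI g)) mulKVg mulgA.
  - by rewrite expr0n eqn0Ngt l_gt0.
  - by rewrite mul0r mulr0 scaler0.
have [_ hu _ _] := hH; have [f [fi fx _]] := hu _ _ _ rr.
pose d w (h : H) : K^o := f h (s w) (s 1%g).
have ld w : linear (d w) by move=> c u v; rewrite /d linearP !mxE.
exists (fun w => linfun (d w)); split=> [w|w g h|w h]; rewrite !linfunE // /d.
- by rewrite rmorph1 mxE (inj_eq (can_inj rs)).
- have E : f (i g * h) = f (i g) * f h by exact: rmorphM. by rewrite E fi rhoE rs.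
- have E : f (x * h) = f x * f h by exact: rmorphM. by rewrite E fx mul0r mxE.
Qed.

(** x acts by a nonzero nilpotent matrix of size 2, on which g acts by
    diag(1, chi g). *)
Lemma x_neq0 : (1 < l)%N -> x != 0.
Proof.
move=> l1; pose y : 'M[K]_2 := delta_mx 0 1.
pose j (g : G) : 'M[K]_2 := diag_mx (\row_k if k == 0 then 1 else chi g).
have rr : datum_rel chi l j y.
  split=> [|g h||g].
  - by apply/matrixP => p q; rewrite !mxE chi1 if_same.
  - rewrite /j -[X in _ = X]/(_ *m _) mulmx_diag; congr diag_mx.
    by apply/rowP => k; rewrite !mxE; case: ifP; rewrite ?mulr1.
  - by rewrite -(subnK l1) exprD expr2 -[y * y]/(y *m y) mul_delta_mx_0 ?mulr0.
  - apply/matrixP => p q; rewrite -[y * _]/(y *m _) -[_ * y]/(_ *m y).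
    rewrite mul_mx_diag mxE [RHS]mxE mul_diag_mx !mxE.
    by case: (p =P 0) => _ /=; case: (q =P 1) => [->|_] /=; rewrite ?(mul0r, mulr0, mul1r, mulr1).
have [_ hu _ _] := hH; have [f [_ fx _]] := hu _ _ _ rr.
apply/eqP => x0; have := congr1 (fun B : 'M[K]_2 => B 0 1) fx.
by rewrite x0 rmorph0 !mxE => /esym/eqP; rewrite oner_eq0.
Qed.

Definition delta : G -> D := projT1 (cid coefficient_exists).

Lemma delta_1 w : delta w 1 = (w == 1%g)%:R :> K.
Proof. by rewrite /delta; case: cid => ? []. Qed.
Lemma delta_iM w g h : delta w (i g * h) = delta (g^-1 * w)%g h :> K.
Proof. by rewrite /delta; case: cid => ? []. Qed.
Lemma delta_xM w h : delta w (x * h) = 0 :> K.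
Proof. by rewrite /delta; case: cid => ? []. Qed.

(** The extension to H of a function on G, through the projection of H onto the
    group algebra that kills x. *)
Definition hat (phi : G -> K) : D := \sum_w phi w *: delta w.

Lemma hatE phi h : hat phi h = \sum_w phi w * (delta w h : K) :> K.
Proof. by rewrite sum_lfunE; apply: eq_bigr => w _; rewrite scale_lfunE. Qed.

Lemma hat_iM phi g h : hat phi (i g * h) = hat (fun w => phi (g * w)%g) h :> K.
Proof.
rewrite !hatE (reindex_inj (mulgI g)) /=; apply: eq_bigr => w _.
by rewrite delta_iM mulKg.
Qed.

Lemma hat_xM phi h : hat phi (x * h) = 0 :> K.
Proof. by rewrite hatE big1 // => w _; rewrite delta_xM mulr0. Qed.

Lemma hat_1 phi : hat phi 1 = phi 1%g :> K.
Proof.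
rewrite hatE (bigD1 1%g) //= big1 => [|w /negPf w1]; first by rewrite delta_1 eqxx mulr1 addr0.
by rewrite delta_1 w1 mulr0.
Qed.

Lemma hat_i phi g : hat phi (i g) = phi g :> K.
Proof. by rewrite -[i g]mulr1 hat_iM hat_1 mulg1. Qed.

Lemma hat_x phi : hat phi x = 0 :> K.
Proof. by rewrite -[x]mulr1 hat_xM. Qed.

Lemma i_inj : injective i.
Proof.
move=> g h e; have := hat_i (fun w => (w == g)%:R) h.
by rewrite -e hat_i eqxx; case: eqP => // _ /eqP; rewrite oner_eq0.
Qed.

Lemma chi_char : is_char chi. Proof. by []. Qed.

Lemma hat_char_iM phi g h : is_char phi ->
  hat phi (i g * h) = phi g * (hat phi h : K) :> K.
Proof.
move=> [_ pM]; rewrite hat_iM !hatE mulr_sumr; apply: eq_bigr => w _.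
by rewrite pM mulrA.
Qed.

Lemma hatM phi h k : is_char phi ->
  hat phi (h * k) = (hat phi h : K) * (hat phi k : K) :> K.
Proof.
move=> hp; move: h; apply: (@linear_ext K^o).
- exact: linear_comp (linearP _) (linear_mulr k).
- by move=> c u v; rewrite dual_linP mulrDl -mulrA.
- by rewrite mul1r hat_1; case: hp => -> _; rewrite mul1r.
- by move=> g h e; rewrite -mulrA !hat_char_iM // e mulrA.
- by move=> h e; rewrite -mulrA !hat_xM mul0r.
Qed.

Lemma eq_functional (f f' : D) :
  f 1 = f' 1 -> (forall g h, f h = f' h -> f (i g * h) = f' (i g * h)) ->
  (forall h, f h = f' h -> f (x * h) = f' (x * h)) -> f = f'.
Proof. by move=> e1 ei ex; apply/lfunP; apply: (@linear_ext K^o) => //; exact: linearP. Qed.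

Lemma hat_eps : hat (fun _ => 1) = counit H.
Proof.
have ht : is_char (fun _ => 1) by split=> *; rewrite ?mulr1.
apply: eq_functional => [|g h e|h _].
- by rewrite hat_1 counit1.
- by rewrite hat_char_iM // eps_iM e mul1r.
- by rewrite hat_xM eps_xM.
Qed.

(** An algebra map to K kills the nilpotent element x, so it is determined by its
    restriction to G. *)
Lemma multiplicative_hat (f : D) : f 1 = 1 :> K ->
  (forall h k, f (h * k) = (f h : K) * (f k : K) :> K) ->
  is_char (fun g => f (i g)) /\ f = hat (fun g => f (i g)).
Proof.
move=> f1 fM; have hp : is_char (fun g => f (i g)).
  by split=> [|g h]; rewrite ?i1 // iM fM.
split=> //; apply: eq_functional => [|g h e|h _].
- by rewrite hat_1 i1.
- by rewrite hat_char_iM // -e fM.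
- rewrite hat_xM fM (_ : (f x : K) = 0) ?mul0r //; apply/eqP.
  have : (f x : K) ^+ l == 0.
    have -> : (f x : K) ^+ l = f (x ^+ l).
      by elim: l => [|n IH]; rewrite ?expr0 ?f1 // !exprS fM IH.
    by rewrite xl0 linear0.
  by rewrite expf_eq0 => /andP[].
Qed.

(** * Twisting by a character *)

(** For a character al this is the automorphism of H that scales g by [al g] and x
    by [al a]. *)
Definition tau (al : G -> K) (h : H) : H :=
  sw2 (fun u v => (hat al v : K) *: u) h.

Lemma bilin_tau al : bilin (fun u v => (hat al v : K) *: u : H).
Proof.
split=> p c u v; first by rewrite scalerDr !scalerA mulrC.
by rewrite dual_linP scalerDl scalerA.
Qed.

Lemma lin_tau al : linear (tau al). Proof. exact: sw2_lin. Qed.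

Lemma tau_1 al : is_char al -> tau al 1 = 1.
Proof. by case=> a1 _; rewrite /tau sw2_1 ?hat_1 ?a1 ?scale1r //; exact: bilin_tau. Qed.

Lemma tau_iM al g h : is_char al -> tau al (i g * h) = al g *: (i g * tau al h).
Proof.
move=> ha; rewrite /tau sw2_iM; last exact: bilin_tau.
rewrite scalerAl (sw2_comp _ _ (linear_mull _)); apply: eq_sw2 => u v.
by rewrite hat_char_iM // -scalerAl -scalerAr scalerA.
Qed.

Lemma tau_xM al h : is_char al -> tau al (x * h) = al a *: (x * tau al h).
Proof.
move=> ha; rewrite /tau sw2_xM; last exact: bilin_tau.
rewrite [X in _ + X](_ : _ = 0) ?addr0.
  rewrite scalerAl (sw2_comp _ _ (linear_mull _)); apply: eq_sw2 => u v.
  by rewrite hat_char_iM // -scalerAl -scalerAr scalerA.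
by rewrite /sw2 /tlift big1 // => p _; rewrite big1 // => q _; rewrite hat_xM scale0r scaler0.
Qed.

Lemma eps_tau al h : is_char al -> (eps (tau al h) : K) = hat al h.
Proof.
move=> ha; move: h; apply: (@linear_ext K^o).
- exact: linear_comp (linearP _) (lin_tau al).
- exact: linearP.
- by rewrite tau_1 // counit1 hat_1; case: ha.
- by move=> g h e; rewrite tau_iM // linearZ /= eps_iM e hat_char_iM.
- by move=> h e; rewrite tau_xM // linearZ /= eps_xM hat_xM; exact: mulr0.
Qed.

Lemma tauK al al' : is_char al -> is_char al' -> (forall g, al g * al' g = 1) ->
  cancel (tau al) (tau al').
Proof.
move=> ha ha' e; apply: linear_ext.
- exact: linear_comp (lin_tau _) (lin_tau _).
- by [].
- by rewrite !tau_1.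
- by move=> g h eh; rewrite tau_iM // linearZf ?tau_iM ?scalerA ?e ?scale1r ?eh //; exact: lin_tau.
- by move=> h eh; rewrite tau_xM // linearZf ?tau_xM ?scalerA ?e ?scale1r ?eh //; exact: lin_tau.
Qed.

(** * Group-like elements of H *)

Lemma delta_i w g : delta w (i g) = (g == w)%:R :> K.
Proof. by rewrite -[i g]mulr1 delta_iM delta_1 -(inj_eq (mulgI g)) mulKVg mulg1 eq_sym. Qed.

(** The grading of H by the degree in x, as an action of scalars c by Hopf maps. *)
Lemma scaling_exists (c : K) : exists th : H -> H,
  [/\ linear th, th 1 = 1, forall g h, th (i g * h) = i g * th h
    & forall h, th (x * h) = c *: (x * th h)].
Proof.
have rr : datum_rel chi l i (c *: x).
  split=> [|g h||g]; [exact: i1|exact: iM| |].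
    by rewrite exprZn xl0 scaler0.
  by rewrite -scalerAl x_iE -!scalerAr !scalerA mulrC.
have [_ hu _ _] := hH; have [f [fi fx _]] := hu _ _ _ rr.
exists f; split=> [||g h|h]; first by move=> k u v; rewrite linearP.
- exact: rmorph1.
- have -> : f (i g * h) = f (i g) * f h by exact: rmorphM.
  by rewrite fi.
- have -> : f (x * h) = f x * f h by exact: rmorphM.
  by rewrite fx -scalerAl.
Qed.

(** Let [th c] scale x by c. Then th c b is a polynomial p in c with coefficients
    in H, and for a functional f the value f (th c b) is a polynomial P f in c of
    degree at most that of p. As b is group-like, P (f * f) is the square of P f,
    so the degree of P f for an f that does not vanish on the leading
    coefficient of p must be 0. Thus b = th 0 b lies in the span of G, where
    linearly independent group-like elements leave only the elements of G. *)
Lemma grouplike_in_G (b : H) :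
  (forall f f' : D, dual_mul f f' b = (f b : K) * (f' b : K) :> K) ->
  eps b = 1 :> K -> exists u, b = i u.
Proof.
move=> bM b1; pose th c := projT1 (cid (scaling_exists c)).
have thP c : [/\ linear (th c), th c 1 = 1, forall g h, th c (i g * h) = i g * th c h
    & forall h, th c (x * h) = c *: (x * th c h)] by rewrite /th; case: cid.
have lth c : linear (th c) by have [] := thP c.
have th_id h : th 1 h = h.
  move: h; apply: linear_ext => // [|g h e|h e]; case: (thP 1) => // _ _ ei ex.
    by rewrite ei e.
  by rewrite ex e scale1r.
have th_0 h : th 0 h = \sum_w (delta w h : K) *: i w.
  move: h; apply: linear_ext => // [c u v||g h e|h _]; case: (thP 0) => // _ e1 ei ex.
  - rewrite scaler_sumr -big_split; apply: eq_bigr => w _ /=.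
    by rewrite dual_linP scalerDl scalerA.
  - rewrite e1 (bigD1 1%g) //= big1 => [|w /negPf w1]; last by rewrite delta_1 w1 scale0r.
    by rewrite delta_1 eqxx scale1r i1 addr0.
  - rewrite ei e mulr_sumr [RHS](reindex_inj (mulgI g)) /=; apply: eq_bigr => w _.
    by rewrite delta_iM mulKg iM -scalerAr.
  - by rewrite ex scale0r big1 // => w _; rewrite delta_xM scale0r.
have th_sw2 (V : vectType K) (F : H -> H -> V) c h : bilin F ->
    sw2 F (th c h) = sw2 (fun u v => F (th c u) (th c v)) h.
  move=> bF; have [_ e1 ei ex] := thP c; have lt := lth c.
  have bF' : bilin (fun u v => F (th c u) (th c v)).
    by case: bF => Fl Fr; split=> w k u v; rewrite lt ?Fl ?Fr.
  move: h F bF bF'; apply: left_ind => [k h h' eh eh'||g h eh|h eh] F bF bF'.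
  - by rewrite lt !sw2_lin eh ?eh'.
  - by rewrite e1 !sw2_1 // e1.
  - rewrite ei !sw2_iM // eh; [|exact: bilin_mul|].
      by apply: eq_sw2 => u v; rewrite !ei.
    by case: (bilin_mul (i g) (i g) bF) => Fl Fr; split=> w k u v; rewrite lt ?Fl ?Fr.
  - rewrite ex linearZf; last exact: sw2_lin.
    rewrite !sw2_xM // scalerDr; congr (_ + _).
    + rewrite eh; [|exact: bilin_mul|].
        rewrite (sw2_comp (g := fun w => c *: w)) => [|k u v]; last first.
          by rewrite scalerDr !scalerA mulrC.
        apply: eq_sw2 => u v; rewrite ex ei; case: bF => Fl _.
        by rewrite (linearZf _ _ (Fl _)).
      by case: (bilin_mul x (i a) bF) => Fl Fr; split=> w k u v; rewrite lt ?Fl ?Fr.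
    + have bx : bilin (fun u v => F u (x * v)).
        by case: bF => Fl Fr; split=> w k u v; rewrite ?Fl // mulrDr -scalerAr Fr.
      rewrite eh //.
        rewrite (sw2_comp (g := fun w => c *: w)) => [|k u v]; last first.
          by rewrite scalerDr !scalerA mulrC.
        apply: eq_sw2 => u v; rewrite ex; case: bF => _ Fr.
        by rewrite (linearZf _ _ (Fr _)).
      by case: bx => Fl Fr; split=> w k u v; rewrite lt ?Fl ?Fr.
have [p pE] : exists p : {poly H}, forall c, th c b = p.[c%:A].
  move: {bM b1} b; apply: left_ind => [k h h' [p hp] [q hq]||g h [p hp]|h [p hp]].
  - by exists ((k%:A)%:P * p + q) => c; rewrite (lth c) hornerD hornerCM hp hq mulr_algl.
  - by exists 1 => c; have [_ -> _ _] := thP c; rewrite hornerC.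
  - by exists ((i g)%:P * p) => c; have [_ _ -> _] := thP c; rewrite hornerCM hp.
  - exists (x%:P * p * 'X) => c; have [_ _ _ ->] := thP c.
    by rewrite hornerMX hornerCM hp mulr_algr.
pose P (f : D) : {poly K} := \poly_(j < size p) (f p`_j : K).
have PE (f : D) c : (P f).[c] = f (th c b).
  rewrite pE (horner_coef p) linear_sum horner_poly; apply: eq_bigr => j _ /=.
  have -> : (c%:A : H) ^+ j = (c ^+ j)%:A by rewrite exprZn expr1n.
  by rewrite mulr_algr linearZ /= mulrC.
have PM f : P (dual_mul f f) = P f * P f.
  apply: (poly_eq_char0 charK) => c; rewrite hornerM !PE dual_mulE th_sw2; last exact: bilin_fg.
  have lf : linear (fun h => f (th c h)) by exact: linear_comp (linearP f) (lth c).
  pose ff : D := linfun (fun h => f (th c h)).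
  have := bM ff ff; rewrite dual_mulE !linfunE // => <-.
  by apply: (@eq_sw2 K^o) => u v; rewrite !linfunE.
have sp : (size p <= 1)%N.
  case: (posnP (size p)) => [->//|sp0].
  have p0 : lead_coef p != 0 by rewrite lead_coef_eq0 -size_poly_gt0.
  have [f f1] := functional_eq1 p0.
  have sP : size (P f) = size p by rewrite size_poly_eq // -lead_coefE f1 oner_neq0.
  have Pf0 : P f != 0 by rewrite -size_poly_gt0 sP.
  have := size_poly (size p) (fun j => dual_mul f f p`_j : K).
  rewrite -/(P _) PM size_mul // sP.
  by case: (size p) sp0 => // n _; rewrite addnS /= -[X in (_ <= X)%N]addn0 leq_add2l.
have bE : b = \sum_w (delta w b : K) *: i w.
  by rewrite -th_0 -{1}[b]th_id !pE (size1_polyC sp) !hornerC.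
have dE u v : (delta u b : K) * (delta v b : K) = (u == v)%:R * (delta u b : K).
  rewrite -bM {1}bE linear_sum /= (bigD1 u) //= big1 => [|w wu].
    rewrite linearZ /= dual_mulE sw2_i; last exact: bilin_fg.
    by rewrite !delta_i eqxx mul1r addr0; exact: mulrC.
  rewrite linearZ /= dual_mulE sw2_i; last exact: bilin_fg.
  by rewrite !delta_i (negPf wu) mul0r; exact: mulr0.
have [u u0] : exists u, (delta u b : K) != 0.
  apply: contrapT => hn; have b0 : b = 0.
    rewrite bE big1 // => w _; have [->|/eqP hw] := eqVneq (delta w b : K) 0.
      by rewrite scale0r.
    by case: hn; exists w; apply/eqP.
  by move: b1; rewrite b0 linear0 => /esym/eqP; rewrite oner_eq0.
have bu : b = (delta u b : K) *: i u.
  rewrite {1}bE (bigD1 u) //= big1 ?addr0 // => w wu.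
  have := dE u w; rewrite eq_sym (negPf wu) mul0r => /eqP.
  by rewrite mulf_eq0 (negPf u0) => /eqP ->; rewrite scale0r.
exists u; move: b1; rewrite bu linearZ /= eps_i => e.
by rewrite (_ : (delta u b : K) = 1) ?scale1r // -[LHS]mulr1.
Qed.

(** * The product of the double *)

Local Notation A := (drinfeld_double H).
Local Notation act := Defs.mact.

Lemma dual_mul_l (g : D) : linear (fun f => dual_mul f g).
Proof.
move=> c f f'; apply/lfunP => h; rewrite add_lfunE scale_lfunE !dual_mulE.
by apply: sw2_lincomb => u v; rewrite add_lfunE scale_lfunE mulrDl -mulrA.
Qed.

Lemma dual_mul_r (f : D) : linear (dual_mul f).
Proof.
move=> c g g'; apply/lfunP => h; rewrite add_lfunE scale_lfunE !dual_mulE.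
by apply: sw2_lincomb => u v; rewrite add_lfunE scale_lfunE mulrDr mulrCA.
Qed.

Lemma dual_mul1 (f : D) : dual_mul f eps = f.
Proof.
apply/lfunP => h; rewrite dual_mulE -[h in RHS]counitr.
rewrite (tlift_comp _ _ (linearP f)); apply: eq_tlift => u v.
by rewrite linearZ; exact: mulrC.
Qed.

Lemma dual_1mul (f : D) : dual_mul eps f = f.
Proof.
apply/lfunP => h; rewrite dual_mulE -[h in RHS]counitl.
by rewrite (tlift_comp _ _ (linearP f)); apply: eq_tlift => u v; rewrite linearZ.
Qed.

(** The functional u -> f <- w of the product of the double. *)
Definition sandwich (u : H) (f : D) (w : H) : D := hit_r (hit_l u f) w.

Lemma sandwichE u f w c : sandwich u f w c = f (w * c * u).
Proof. by rewrite hit_rE hit_lE. Qed.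

Lemma sandwich1 f w : sandwich 1 f w = hit_r f w.
Proof. by apply/lfunP => c; rewrite sandwichE hit_rE mulr1. Qed.

Lemma hit_r1 f : hit_r f 1 = f :> D.
Proof. by apply/lfunP => c; rewrite hit_rE mul1r. Qed.

Lemma sandwich_comp u u' f w w' :
  sandwich u (sandwich u' f w') w = sandwich (u * u') f (w' * w).
Proof. by apply/lfunP => c; rewrite !sandwichE !mulrA. Qed.

Lemma sandwich_u f w : linear (fun u => sandwich u f w).
Proof.
move=> c u v; apply/lfunP => h.
by rewrite add_lfunE scale_lfunE !sandwichE mulrDr -scalerAr linearP.
Qed.

Lemma sandwich_f u w : linear (fun f => sandwich u f w).
Proof.
by move=> c f f'; apply/lfunP => h; rewrite !(add_lfunE, scale_lfunE, sandwichE).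
Qed.

Lemma sandwich_w u f : linear (sandwich u f).
Proof.
move=> c w w'; apply/lfunP => h.
by rewrite add_lfunE scale_lfunE !sandwichE !mulrDl -!scalerAl linearP.
Qed.

Lemma hit_r_f w : linear (fun f : D => hit_r f w).
Proof. by move=> c f f'; apply/lfunP => h; rewrite !(add_lfunE, scale_lfunE, hit_rE). Qed.

Lemma dbl_mul_pureE (g f : D) h k : dbl_mul_pure g h f k =
  sw3 (fun h1 h2 h3 => tpure (dual_mul g (sandwich h1 f (T h3))) (h2 * k)) h.
Proof. by []. Qed.

Lemma dbl_mul_trilin (g f : D) k :
  trilin (fun h1 h2 h3 => tpure (dual_mul g (sandwich h1 f (T h3))) (h2 * k)).
Proof.
split=> [v w|u w|u v].
- exact: linear_comp (tpure_l _) (linear_comp (dual_mul_r g) (sandwich_u _ _)).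
- exact: linear_comp (tpure_r _) (linear_mulr k).
- apply: linear_comp (tpure_l _) (linear_comp (dual_mul_r g) _).
  exact: linear_comp (sandwich_w _ _) T_lin.
Qed.

Lemma dbl_mul_pure_lin_h (g f : D) k : linear (fun h => dbl_mul_pure g h f k).
Proof. by move=> c h h'; rewrite !dbl_mul_pureE sw3_lin. Qed.

Lemma sw3_lincomb (V : vectType K) (F F1 F2 : H -> H -> H -> V) c h :
  (forall u v w, F u v w = c *: F1 u v w + F2 u v w) ->
  sw3 F h = c *: sw3 F1 h + sw3 F2 h.
Proof. by move=> e; do 2!apply: sw2_lincomb => ? ?; exact: e. Qed.

Lemma sw3D (V : vectType K) (F F1 F2 : H -> H -> H -> V) h :
  (forall u v w, F u v w = F1 u v w + F2 u v w) -> sw3 F h = sw3 F1 h + sw3 F2 h.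
Proof. by move=> e; do 2!apply: sw2D => ? ?; exact: e. Qed.

Lemma dbl_mul_pure_bilin1 (f : D) k : bilin (fun g h => dbl_mul_pure g h f k).
Proof.
split=> [h c g g'|g]; last exact: dbl_mul_pure_lin_h.
by rewrite !dbl_mul_pureE; apply: sw3_lincomb => u v w; rewrite dual_mul_l tpure_l.
Qed.

Lemma dbl_mul_pure_bilin2 (g : D) h : bilin (fun f k => dbl_mul_pure g h f k).
Proof.
split=> [k c f f'|f c k k']; rewrite !dbl_mul_pureE; apply: sw3_lincomb => u v w.
  by rewrite sandwich_f dual_mul_r tpure_l.
by rewrite mulrDr -scalerAr tpure_r.
Qed.

Lemma dbl_mul_l (t : A) : linear (fun s => dbl_mul s t).
Proof. exact: tlift_linear. Qed.

Lemma dbl_mul_r (s : A) : linear (@dbl_mul _ H s).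
Proof. by move=> c t t'; apply: tlift_lincomb => g h; rewrite tliftP. Qed.

Lemma dbl_mul_tpure (g f : D) h k :
  dbl_mul (tpure g h) (tpure f k) = dbl_mul_pure g h f k.
Proof.
rewrite /dbl_mul tlift_tpure.
  by rewrite tlift_tpure //; exact: dbl_mul_pure_bilin2.
split=> [v c u u'|v c u u']; apply: tlift_lincomb => f' k'.
  by case: (dbl_mul_pure_bilin1 f' k') => -> _.
by case: (dbl_mul_pure_bilin1 f' k') => _ ->.
Qed.

Lemma dbl_mul_1 (g f : D) k : dbl_mul_pure g 1 f k = tpure (dual_mul g f) k.
Proof.
by rewrite dbl_mul_pureE sw3_1 ?T1 ?mul1r ?sandwich1 ?hit_r1 //; exact: dbl_mul_trilin.
Qed.

Lemma sw3_i (V : vectType K) (F : H -> H -> H -> V) g :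
  trilin F -> sw3 F (i g) = F (i g) (i g) (i g).
Proof.
move=> tF; rewrite /sw3 sw2_i; last exact: sw2_bilin.
by rewrite sw2_i //; exact: trilin_bilin.
Qed.

Lemma sw3_x (V : vectType K) (F : H -> H -> H -> V) : trilin F ->
  sw3 F x = F x (i a) (i a) + F 1 x (i a) + F 1 1 x.
Proof.
move=> tF; rewrite /sw3 sw2_x; last exact: sw2_bilin.
by rewrite sw2_x ?sw2_1 //; exact: trilin_bilin.
Qed.

Lemma dbl_mul_i (g f : D) u k : dbl_mul_pure g (i u) f k =
  tpure (dual_mul g (sandwich (i u) f (i u^-1%g))) (i u * k).
Proof. by rewrite dbl_mul_pureE sw3_i ?T_i //; exact: dbl_mul_trilin. Qed.

Lemma dbl_mul_x (g f : D) k : dbl_mul_pure g x f k =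
  tpure (dual_mul g (sandwich x f (i a^-1%g))) (i a * k)
  + tpure (dual_mul g (hit_r f (i a^-1%g))) (x * k)
  + tpure (dual_mul g (hit_r f (T x))) k.
Proof.
by rewrite dbl_mul_pureE sw3_x ?T_i ?sandwich1 ?mul1r //; exact: dbl_mul_trilin.
Qed.

(** * Modules over the double *)

(** A module over the double as an action [X] of H and an action [Y] of its dual.
    The fields only mention the generators of H: multiplicativity of [X] and the
    straightening rule for all of H follow ([rep_XM], [rep_straighten]). *)
Record double_rep (M : vectType K) (X : H -> M -> M) (Y : D -> M -> M) : Prop :=
  DoubleRep {
    rep_Xbilin : bilin X;
    rep_Ybilin : bilin Y;
    rep_X1 : forall m, X 1 m = m;
    rep_Xi : forall g h m, X (i g * h) m = X (i g) (X h m);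
    rep_Xx : forall h m, X (x * h) m = X x (X h m);
    rep_Y1 : forall m, Y eps m = m;
    rep_YM : forall f g m, Y (dual_mul f g) m = Y f (Y g m);
    rep_XiY : forall g f m,
      X (i g) (Y f m) = Y (sandwich (i g) f (i g^-1%g)) (X (i g) m);
    rep_XxY : forall f m,
      X x (Y f m) = Y (sandwich x f (i a^-1%g)) (X (i a) m)
        + Y (hit_r f (i a^-1%g)) (X x m) + Y (hit_r f (T x)) m
  }.

Definition modX (M : preModule A) (h : H) (m : M) : M :=
  act (tpure (eps : D) h : A) m.
Definition modY (M : preModule A) (f : D) (m : M) : M :=
  act (tpure f (1 : H) : A) m.

Lemma double_act_tpure (M : preModule A) (f : D) h (m : M) : is_module M ->
  act (tpure f h : A) m = modY f (modX h m).
Proof.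
move=> [_ _ mM]; rewrite /modX /modY -mM /= dbl_mul_tpure dbl_mul_1.
by rewrite dual_mul1.
Qed.

Lemma modXY_bilin (M : preModule A) (m : M) : is_module M ->
  bilin (fun f h => modY f (modX h m)).
Proof.
move=> [[b1 b2] _ _]; split=> [h|f].
  exact: linear_comp (b1 _) (tpure_l _).
exact: linear_comp (b2 _) (linear_comp (b1 _) (tpure_r _)).
Qed.

Lemma double_actE (M : preModule A) (t : A) (m : M) : is_module M ->
  act t m = tlift (fun f h => modY f (modX h m)) t.
Proof.
move=> mM; move: t; apply: tens_eq => [||f h].
- by case: mM => -[b1 _] _ _; exact: b1.
- exact: tlift_linear.
- by rewrite double_act_tpure // tlift_tpure //; exact: modXY_bilin.
Qed.

Lemma module_rep (M : preModule A) : is_module M -> double_rep (@modX M) (@modY M).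
Proof.
move=> mM; have [[b1 b2] m1 mm] := mM; split=> //.
- split=> [m|h]; last exact: b2.
  exact: linear_comp (b1 m) (tpure_r _).
- split=> [m|f]; last exact: b2.
  exact: linear_comp (b1 m) (tpure_l _).
- move=> g h m; rewrite /modX -mm /= dbl_mul_tpure dbl_mul_i dual_1mul.
  congr (act (tpure _ _ : A) _); apply/lfunP => c.
  by rewrite sandwichE !counitM !eps_i mul1r mulr1.
- move=> h m; rewrite /modX -mm /= dbl_mul_tpure dbl_mul_x !dual_1mul.
  have e0 : sandwich x eps (i a^-1%g) = 0.
    by apply/lfunP => c; rewrite sandwichE !counitM eps_x mulr0 zero_lfunE.
  have e1 : hit_r (eps : D) (T x) = 0.
    have eT : (eps (T x) : K) = 0.
      by rewrite T_x (raddfN eps) /= counitM eps_x mulr0 oppr0.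
    by apply/lfunP => c; rewrite hit_rE counitM eT mul0r zero_lfunE.
  have e2 : hit_r (eps : D) (i a^-1%g) = eps.
    by apply/lfunP => c; rewrite hit_rE eps_iM.
  by rewrite e0 e1 e2 !(linear0f (tpure_l _)) add0r addr0.
- by move=> f g m; rewrite /modY -mm /= dbl_mul_tpure dbl_mul_1.
- move=> g f m; rewrite -double_act_tpure // /modX /modY -mm /= dbl_mul_tpure dbl_mul_i.
  by rewrite dual_1mul mulr1.
- move=> f m; rewrite -!double_act_tpure // /modX /modY -mm /= dbl_mul_tpure dbl_mul_x.
  by rewrite !dual_1mul !mulr1 !(linearDf _ _ (b1 m)).
Qed.

Definition rep_module (M : vectType K) (X : H -> M -> M) (Y : D -> M -> M) :
  preModule A := @PreModule K A M (fun t m => tlift (fun f h => Y f (X h m)) t).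

Section Rep.
Variables (M : vectType K) (X : H -> M -> M) (Y : D -> M -> M).
Hypothesis r : double_rep X Y.

Lemma rep_XM h k m : X (h * k) m = X h (X k m).
Proof.
have [b1 b2] := rep_Xbilin r; move: h; apply: linear_ext => [||||].
- exact: linear_comp (b1 m) (linear_mulr k).
- exact: b1.
- by rewrite mul1r (rep_X1 r).
- by move=> g h e; rewrite -mulrA !(rep_Xi r) e.
- by move=> h e; rewrite -mulrA !(rep_Xx r) e.
Qed.

Lemma rep_XY_bilin m : bilin (fun f h => Y f (X h m)).
Proof.
have [b1 b2] := rep_Xbilin r; have [c1 c2] := rep_Ybilin r.
split=> [h|f]; first exact: c1.
exact: linear_comp (c2 f) (b1 m).
Qed.

Lemma rep_trilin f m : trilin (fun h1 h2 h3 => Y (sandwich h1 f (T h3)) (X h2 m)).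
Proof.
have [b1 b2] := rep_XY_bilin m; split=> [v w|u w|u v].
- exact: linear_comp (b1 _) (sandwich_u _ _).
- exact: b2.
- exact: linear_comp (b1 _) (linear_comp (sandwich_w _ _) T_lin).
Qed.

(** The rule X h (Y f m) = sum of the Y (h_(1) -> f <- T h_(3)) (X h_(2) m) passes
    from h to g * h and x * h, because the rule for a generator can be applied
    under the sum for h. *)
Lemma rep_straighten h f m :
  sw3 (fun h1 h2 h3 => Y (sandwich h1 f (T h3)) (X h2 m)) h = X h (Y f m).
Proof.
have [b1 b2] := rep_Xbilin r; have [c1 c2] := rep_Ybilin r.
move: h; apply: linear_ext => [|||g h e|h e].
- exact: sw3_lin.
- exact: b1.
- rewrite sw3_1; last exact: rep_trilin.
  by rewrite T1 sandwich1 hit_r1 !(rep_X1 r).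
- rewrite sw3_iM ?(rep_Xi r) -?e; last exact: rep_trilin.
  rewrite (sw3_comp _ _ (b2 (i g))); apply: eq_sw3 => u v w.
  by rewrite TM T_i (rep_Xi r) (rep_XiY r) sandwich_comp.
- rewrite sw3_xM ?(rep_Xx r) -?e; last exact: rep_trilin.
  rewrite (sw3_comp _ _ (b2 x)).
  pose P1 u v w := Y (sandwich (x * u) f (T (i a * w))) (X (i a * v) m).
  pose P2 u v w := Y (sandwich u f (T (i a * w))) (X (x * v) m).
  pose P3 u v w := Y (sandwich u f (T (x * w))) (X v m).
  rewrite [RHS](sw3D (F1 := fun u v w => P1 u v w + P2 u v w) (F2 := P3)).
    by rewrite [in RHS](sw3D (F1 := P1) (F2 := P2)).
  move=> u v w; rewrite (rep_XxY r) /P1 /P2 /P3 !TM T_i (rep_Xi r) (rep_Xx r).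
  by rewrite -!sandwich1 !sandwich_comp !mul1r.
Qed.
End Rep.

Lemma rep_is_module (M : vectType K) (X : H -> M -> M) (Y : D -> M -> M) :
  double_rep X Y -> is_module (rep_module X Y).
Proof.
move=> r; have [b1 b2] := rep_Xbilin r; have [c1 c2] := rep_Ybilin r.
have lm (t : A) : linear (act t : rep_module X Y -> rep_module X Y).
  by move=> c u v; apply: tlift_lincomb => f h; rewrite b2 c2.
have actp (f : D) h (m : rep_module X Y) : act (tpure f h : A) m = Y f (X h m).
  by rewrite /= tlift_tpure //; exact: (rep_XY_bilin r).
have lt (m : rep_module X Y) : linear (fun t : A => act t m) by exact: tlift_linear.
split=> [|m|s t m].
- by split=> [m|t]; [exact: lt|exact: lm].
- by rewrite actp (rep_X1 r) (rep_Y1 r).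
move: s; apply: tens_eq => [||g h].
- exact: linear_comp (lt m) (dbl_mul_l t).
- exact: lt.
rewrite -[bmul _ _]/(dbl_mul _ _).
move: t; apply: tens_eq => [||f k].
- exact: linear_comp (lt m) (dbl_mul_r _).
- exact: linear_comp (lm _) (lt m).
rewrite dbl_mul_tpure dbl_mul_pureE !actp -(rep_straighten r) (sw3_comp _ _ (lt m)).
rewrite (sw3_comp _ _ (c2 g)); apply: eq_sw3 => u v w.
by rewrite actp (rep_YM r) (rep_XM r).
Qed.

(** * Twisting modules by one-dimensional modules *)

(** For a character al with al a = chi u this is the automorphism of the double
    given by the coproduct followed by the one-dimensional module (al, u) on the
    second factor. *)
Definition twist al u (t : A) : A :=
  tlift (fun f h => tpure (hit_r f (i u)) (tau al h)) t.

Lemma twist_lin al u : linear (twist al u).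
Proof. exact: tlift_linear. Qed.

Lemma twist_tpure al u (f : D) h :
  twist al u (tpure f h) = tpure (hit_r f (i u)) (tau al h).
Proof.
rewrite /twist tlift_tpure //; split=> [v|v].
  exact: linear_comp (tpure_l _) (hit_r_f _).
exact: linear_comp (tpure_r _) (lin_tau al).
Qed.

Lemma twistK al u al' u' : is_char al -> is_char al' ->
  (forall g, al g * al' g = 1) -> (u * u' = 1)%g ->
  cancel (twist al u) (twist al' u').
Proof.
move=> ha ha' e eu; apply: tens_eq => [||f h] //.
  exact: linear_comp (twist_lin _ _) (twist_lin _ _).
rewrite !twist_tpure tauK //; congr (tpure _ _); apply/lfunP => c.
by rewrite !hit_rE mulrA -iM eu i1 mul1r.
Qed.

Definition twisted al u (M : preModule A) : preModule A :=
  @PreModule K A M (fun t m => act (twist al u t) m).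

Lemma tau_i al g : is_char al -> tau al (i g) = al g *: i g.
Proof. by move=> ha; rewrite -[i g]mulr1 tau_iM // tau_1. Qed.

Lemma tau_x al : is_char al -> tau al x = al a *: x.
Proof. by move=> ha; rewrite -[x in LHS]mulr1 tau_xM // tau_1 // mulr1. Qed.

Lemma hit_r_mul f g u : hit_r (dual_mul f g) (i u) = dual_mul (hit_r f (i u)) (hit_r g (i u)) :> D.
Proof.
apply/lfunP => c; rewrite hit_rE !dual_mulE sw2_iM; last exact: bilin_fg.
by apply: (@eq_sw2 K^o) => p q; rewrite !hit_rE.
Qed.

(** Only the straightening rule for x restricts (al, u): its last term, which
    moves u past x, acquires the factor chi u instead of al a. *)
Lemma twist_rep (M : vectType K) (X : H -> M -> M) (Y : D -> M -> M) al u :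
  is_char al -> al a = chi u -> double_rep X Y ->
  double_rep (fun h => X (tau al h)) (fun f => Y (hit_r f (i u))).
Proof.
move=> ha au r; have [b1 b2] := rep_Xbilin r; have [c1 c2] := rep_Ybilin r.
have XZ c h m : X (c *: h) m = c *: X h m by rewrite (linearZf _ _ (b1 m)).
split.
- by split=> m; [exact: linear_comp (b1 m) (lin_tau al)|exact: b2].
- by split=> m; [exact: linear_comp (c1 m) (hit_r_f _)|exact: c2].
- by move=> m; rewrite tau_1 ?(rep_X1 r).
- by move=> g h m; rewrite tau_iM // tau_i // !XZ (rep_Xi r).
- by move=> h m; rewrite tau_xM // tau_x // !XZ (rep_Xx r).
- move=> m; rewrite -[RHS](rep_Y1 r); congr (Y _ _).
  by apply/lfunP => c; rewrite hit_rE eps_iM.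
- by move=> f g m; rewrite hit_r_mul (rep_YM r).
- move=> g f m; rewrite tau_i // !XZ (rep_XiY r) (linearZf _ _ (c2 _)).
  congr (_ *: Y _ _); apply/lfunP => c.
  by rewrite !(sandwichE, hit_rE) !mulrA (iC u).
- move=> f m; rewrite tau_x // tau_i // !XZ (rep_XxY r) !(linearZf _ _ (c2 _)).
  rewrite !scalerDr; congr (_ + _ + _).
  + by congr (_ *: Y _ _); apply/lfunP => c; rewrite !(sandwichE, hit_rE) !mulrA (iC u).
  + by congr (_ *: Y _ _); apply/lfunP => c; rewrite !(sandwichE, hit_rE) !mulrA (iC u).
  rewrite -(linearZf _ _ (c1 _)); congr (Y _ _); apply/lfunP => c.
  rewrite scale_lfunE !hit_rE T_x.
  have -> : - (i a^-1%g * x) * (i u * c) = chi u *: (i u * (- (i a^-1%g * x) * c)).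
    rewrite !mulNr mulrN scalerN; congr (- _).
    by rewrite !mulrA -[i a^-1%g * x * _]mulrA x_iE -scalerAr -!scalerAl !mulrA (iC u).
  by rewrite linearZ au.
Qed.

Lemma twistedE al u (M : preModule A) : is_module M ->
  twisted al u M = rep_module (fun h => @modX M (tau al h)) (fun f => @modY M (hit_r f (i u))).
Proof.
move=> mM; rewrite /twisted /rep_module; congr PreModule.
apply: funext => t; apply: funext => m; rewrite double_actE // /twist.
by rewrite tlift_comp_pure //; exact: modXY_bilin.
Qed.

#[local] Opaque twist.

Lemma twisted_module al u (M : preModule A) : is_char al -> al a = chi u ->
  is_module M -> is_module (twisted al u M).
Proof.
by move=> ha au mM; rewrite twistedE //; apply/rep_is_module/twist_rep/module_rep.
Qed.

Lemma char_inv (al : G -> K) : is_char al -> is_char (fun g => al g^-1%g).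
Proof.
case=> a1 aM; split=> [|g h]; first by rewrite invg1.
by rewrite invMg mulCG aM.
Qed.

Lemma twistKV al u : is_char al -> cancel (twist (fun g => al g^-1%g) u^-1%g) (twist al u).
Proof.
move=> ha; apply: twistK; rewrite ?mulVg //; first exact: char_inv.
by move=> g; rewrite mulrC char_V.
Qed.

Lemma twisted_simple al u (M : preModule A) : is_char al -> al a = chi u ->
  simple_module M -> simple_module (twisted al u M).
Proof.
move=> ha au [mM M0 Ms]; split=> //; first exact: twisted_module.
move=> U hU; apply: Ms => t m mU; rewrite -[t](twistKV u ha).
exact: (hU (twist (fun g => al g^-1%g) u^-1%g t) m mU).
Qed.

Lemma eq_act_iso (M : vectType K) (p q : A -> M -> M) :
  (forall t m, p t m = q t m) -> mod_iso (@PreModule K A M p) (@PreModule K A M q).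
Proof.
move=> e; exists \1%VF; split; first by exists id => m; rewrite id_lfunE.
by move=> t m; rewrite !id_lfunE /= e.
Qed.

Lemma mod_iso_of (M M' : preModule A) (f : M -> M') (f' : M' -> M) :
  linear f -> cancel f f' -> cancel f' f ->
  (forall t m, f (act t m) = act t (f m)) -> mod_iso M M'.
Proof.
move=> lf fK f'K fa; exists (linfun f); split; last by move=> t m; rewrite !linfunE.
by exists f' => m; rewrite linfunE.
Qed.

Definition trivial_module : preModule A :=
  rep_module (fun (h : H) (c : K^o) => (eps h : K) *: c) (fun (f : D) (c : K^o) => (f 1 : K) *: c).

Lemma trivial_rep : double_rep (fun (h : H) (c : K^o) => (eps h : K) *: c)
  (fun (f : D) (c : K^o) => (f 1 : K) *: c).
Proof.
split.
- split=> [m|h] c u v; first by rewrite dual_linP scalerDl scalerA.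
  by rewrite scalerDr !scalerA mulrC.
- split=> [m|f] c u v; last by rewrite scalerDr !scalerA mulrC.
  by rewrite add_lfunE scale_lfunE scalerDl -scalerA.
- by move=> m; rewrite counit1 scale1r.
- by move=> g h m; rewrite eps_iM eps_i scale1r.
- by move=> h m; rewrite eps_xM eps_x !scale0r.
- by move=> m; rewrite counit1 scale1r.
- move=> f g m; rewrite dual_mulE sw2_1 ?scalerA //; exact: bilin_fg.
- by move=> g f m; rewrite eps_i !scale1r sandwichE mulr1 iVi.
- move=> f m; rewrite eps_x eps_i !scale0r scale1r scaler0 addr0 sandwichE hit_rE.
  by rewrite T_x !mulr1 (raddfN f) scaleNr subrr.
Qed.

(** The weight (al, u): by [one_dim_act] a pure tensor f ⊗ h acts on it by
    f u * al h. *)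
Definition one_dim al u : preModule A := twisted al u trivial_module.

Lemma trivial_is_module : is_module trivial_module.
Proof. exact: rep_is_module trivial_rep. Qed.

Lemma one_dim_is_module al u : is_char al -> al a = chi u -> is_module (one_dim al u).
Proof. by move=> ha au; exact: twisted_module trivial_is_module. Qed.

Lemma dim_one_dim al u : \dim {: one_dim al u} = 1%N.
Proof. by rewrite -[{: one_dim al u}%VS]/({: K^o}%VS) regular_fullv dimv1. Qed.

Lemma one_dim_simple al u : is_char al -> al a = chi u -> simple_module (one_dim al u).
Proof.
move=> ha au; split; first exact: one_dim_is_module.
  by rewrite -dimv_eq0 dim_one_dim.
move=> U _; have [->|U0] := eqVneq U 0%VS; [by left|right].
by apply/eqP; rewrite eqEdim subvf dim_one_dim lt0n dimv_eq0.
Qed.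

Lemma one_dim_act al u (f : D) h (c : one_dim al u) : is_char al ->
  act (tpure f h : A) c = ((f (i u) : K) * (hat al h : K)) *: c.
Proof.
move=> ha; rewrite /= -[tlift _ _]/(act (twist al u (tpure f h) : A) (c : trivial_module)).
rewrite twist_tpure /= tlift_tpure; last exact: rep_XY_bilin trivial_rep _.
by rewrite scalerA hit_rE mulr1 eps_tau.
Qed.

(** * The coproduct of the double *)

Definition dual_basis (j : 'I_(\dim {:H})) : D :=
  linfun (fun u : H => coord (vbasis {:H}) j u : K^o).

Lemma dual_basisE j h : dual_basis j h = coord (vbasis {:H}) j h :> K.
Proof. by rewrite /dual_basis linfunE // => c u v; rewrite linearP. Qed.

Lemma dual_basis_sum (f : D) : f = \sum_(j < \dim {:H}) (f (vbasis {:H})`_j : K) *: dual_basis j.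
Proof.
apply/lfunP => h; rewrite sum_lfunE -{1}[h]coord_vbasis_full linear_sum.
apply: eq_bigr => j _; rewrite linearZ scale_lfunE dual_basisE; exact: mulrC.
Qed.

(** f_(1) b * f_(2) is the functional c |-> f (b * c). *)
Lemma dual_comul_evaluate (V : vectType K) (L : D -> V) (f : D) b : linear L ->
  tlift (fun f1 f2 : D => (f1 b : K) *: L f2) (dual_comul f) = L (hit_r f b).
Proof.
move=> lL; have bL : bilin (fun f1 f2 : D => (f1 b : K) *: L f2).
  split=> [g|g] c u v; last by rewrite lL scalerDr !scalerA mulrC.
  by rewrite add_lfunE scale_lfunE scalerDl -scalerA.
have lt := tlift_linear (fun f1 f2 : D => (f1 b : K) *: L f2).
rewrite [hit_r f b]dual_basis_sum (linear_sumZ lL) /dual_comul (linear_sum_ord _ lt).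
under eq_bigr => j _ do rewrite (linear_sumZ lt).
rewrite exchange_big; apply: eq_bigr => j _ /=.
rewrite hit_rE -{2}[b]coord_vbasis_full mulr_suml linear_sum scaler_suml.
apply: eq_bigr => k _; rewrite tlift_tpure // dual_basisE.
by rewrite scalerA -scalerAl (linearZf _ _ (linearP f)); congr (_ *: _); exact: mulrC.
Qed.

Lemma dual_comul_lin : linear (@dual_comul _ H).
Proof.
move=> c f g; rewrite /dual_comul scaler_sumr -big_split; apply: eq_bigr => j _ /=.
rewrite scaler_sumr -big_split; apply: eq_bigr => k _ /=.
by rewrite add_lfunE scale_lfunE scalerDl -scalerA.
Qed.

Lemma dbl_comul_lin : linear (@dbl_comul _ H).
Proof. exact: tlift_linear. Qed.

Lemma dbl_comul_tpure (f : D) h :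
  dbl_comul (tpure f h) = tlift (fun f1 f2 : D =>
    sw2 (fun h1 h2 => tpure (tpure f2 h1 : A) (tpure f1 h2 : A)) h) (dual_comul f).
Proof.
rewrite /dbl_comul tlift_tpure //; split=> [v|v c u w].
  exact: tlift_lin dual_comul_lin.
by apply: tlift_lincomb => f1 f2; rewrite linearP tliftP.
Qed.

(** If F depends on its second argument only through the scalar f_(1) b * ph h_(2),
    then the Sweedler sums over f and h can be carried out separately. *)
Lemma dbl_comul_evaluate (V : vectType K) (F : A -> A -> V) (L : A -> V)
    (f : D) h (ph : H -> K) b : bilin F -> linear L ->
  (forall f1 f2 h1 h2,
     F (tpure f2 h1) (tpure f1 h2) = ((f1 b : K) * ph h2) *: L (tpure f2 h1)) ->
  tlift F (dbl_comul (tpure f h)) = L (tpure (hit_r f b) (sw2 (fun u v => ph v *: u) h)).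
Proof.
move=> bF lL e; rewrite dbl_comul_tpure (tlift_comp _ _ (tlift_linear F)).
rewrite -(@dual_comul_evaluate _ (fun f2 => L (tpure f2 (sw2 (fun u v => ph v *: u) h)))).
  apply: eq_tlift => f1 f2; rewrite (sw2_comp _ _ (tlift_linear F)).
  have l2 : linear (fun k => (f1 b : K) *: L (tpure f2 k)).
    by move=> c u v; rewrite tpure_r lL scalerDr !scalerA mulrC.
  rewrite (sw2_comp _ _ l2); apply: eq_sw2 => u v.
  by rewrite tlift_tpure // e (linearZf _ _ (tpure_r _)) (linearZf _ _ lL) scalerA.
exact: linear_comp lL (tpure_l _).
Qed.

(** Under m |-> m ⊗ 1 the action of t on the tensor product becomes
    m |-> t_(1) m scaled by the character of [one_dim al u] at t_(2). *)
Lemma tensor_one_dim al u (U : preModule A) : is_char al -> al a = chi u ->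
  is_module U -> mod_iso (tensor_module U (one_dim al u)) (twisted al u U).
Proof.
move=> ha au mU; apply: mod_iso_sym.
have [[b1 b2] _ _] := mU; have [[d1 d2] _ _] := one_dim_is_module ha au.
pose one : one_dim al u := (1 : K^o).
pose f (m : twisted al u U) : tensor_module U (one_dim al u) := tpure (m : U) one.
pose f' (t : tensor_module U (one_dim al u)) : twisted al u U :=
  tlift (fun (m : U) (c : K^o) => (c : K) *: m) t.
have bf' : bilin (fun (m : U) (c : K^o) => (c : K) *: m).
  split=> [c k v w|m k c d]; first by rewrite scalerDr !scalerA mulrC.
  by rewrite scalerDl -scalerA.
have oneZ (c : K^o) : c = (c : K) *: (1 : K^o) by rewrite [RHS]mulr1.
have lf : linear f by exact: tpure_l.
apply: (mod_iso_of (f := f) (f' := f')) => //.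
- by move=> m; rewrite /f /f' tlift_tpure // scale1r.
- apply: (@tens_eq _ _ _ (tens U (one_dim al u)) (fun t => f (f' t)) id) => //.
    exact: linear_comp lf (tlift_linear _).
  move=> m c; rewrite /f' tlift_tpure // /f (linearZf _ _ (tpure_l _)).
  by rewrite -(linearZf _ _ (tpure_r _)) -oneZ.
move=> t m; rewrite /f /=.
have e (a1 a2 : A) :
    tlift (fun (v : U) (w : one_dim al u) => tpure (act a1 v) (act a2 w)) (tpure m one)
    = tpure (act a1 (m : U)) (act a2 one).
  rewrite tlift_tpure //; split=> [w|v].
    exact: linear_comp (tpure_l _) (b2 _).
  exact: linear_comp (tpure_r _) (d2 _).
rewrite (eq_tlift _ e).
have bF : bilin (fun a1 a2 : A => tpure (act a1 (m : U)) (act a2 one)).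
  split=> [w|v].
    exact: linear_comp (tpure_l _) (b1 _).
  exact: linear_comp (tpure_r _) (d1 _).
have lL : linear (fun s : A => tpure (act s (m : U)) one).
  exact: linear_comp (tpure_l _) (b1 _).
move: t; apply: tens_eq => [||g h].
- exact: linear_comp lL (twist_lin _ _).
- exact: linear_comp (tlift_linear _) dbl_comul_lin.
rewrite (@dbl_comul_evaluate _ _ _ _ _ (hat al) (i u) bF lL).
  by rewrite twist_tpure.
move=> f1 f2 h1 h2; rewrite one_dim_act //.
exact: (linearZf _ _ (tpure_r _)).
Qed.

(** * One-dimensional modules *)

Hypothesis degenerate : l = 1%N -> a = 1%g /\ forall g, chi g = 1.

(** Either x is nonzero, or a and chi are trivial: arguments that compare
    coefficients of x split along this alternative. *)
Lemma degenerateP : (1 < l)%N \/ a = 1%g /\ forall g, chi g = 1.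
Proof.
have := l_gt0; rewrite leq_eqVlt => /predU1P[/esym/degenerate|]; by [right|left].
Qed.

Lemma ix_scalar_inj g c d : (1 < l)%N -> c *: (i g * x) = d *: (i g * x) -> c = d.
Proof.
move=> l1 /eqP; rewrite -subr_eq0 -scalerBl scaler_eq0 subr_eq0.
case/orP => [/eqP//|/eqP e]; have := x_neq0 l1.
by rewrite -[x]mul1r -(iVi g) -mulrA e mulr0 eqxx.
Qed.

(** On the line V, H acts by an algebra map, hence by a character [al] of G, and
    its dual acts by evaluation at an element b of H that is group-like, hence in
    G. In the straightening rule for x the operator [X x] is zero, and the
    two remaining terms are al a and chi u times the same functional of x. *)
Lemma one_dim_classification (V : preModule A) : is_module V -> \dim {:V} = 1%N ->
  exists al u, [/\ is_char al, al a = chi u & mod_iso V (one_dim al u)].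
Proof.
move=> mV dV; have r := module_rep mV.
have [b1 b2] := rep_Xbilin r; have [c1 c2] := rep_Ybilin r.
pose v := vpick {:V}.
have v0 : v != 0 by rewrite vpick0 -dimv_eq0 dV.
have line (w : V) : exists k, w = k *: v.
  apply/vlineP; suff -> : <[v]>%VS = {:V}%VS by rewrite memvf.
  by apply/eqP; rewrite eqEdim subvf dim_vline v0 dV.
pose k w := projT1 (cid (line w)).
have kE w : w = k w *: v by rewrite /k; case: cid.
have kv c : k (c *: v) = c.
  have /esym/eqP := kE (c *: v).
  by rewrite -subr_eq0 -scalerBl scaler_eq0 (negPf v0) orbF subr_eq0 => /eqP.
have kP c w w' : k (c *: w + w') = c * k w + k w'.
  by rewrite {1}(kE w) {1}(kE w') scalerA -scalerDl kv.
pose al0 : D := linfun (fun h => k (modX h v) : K^o).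
have alE h : al0 h = k (modX h v) :> K by rewrite linfunE // => c p q; rewrite b1 kP.
have Xv h : modX h v = (al0 h : K) *: v by rewrite alE -kE.
pose y f := k (modY f v).
have Yv f : modY f v = y f *: v by rewrite /y -kE.
have [||hal al0E] := @multiplicative_hat al0.
- by rewrite alE (rep_X1 r) -[v]scale1r kv.
- by move=> h h'; rewrite alE (rep_XM r) (Xv h') (linearZf _ _ (b2 h)) Xv scalerA kv mulrC.
set al := fun g => (al0 (i g) : K) in hal al0E.
pose b : H := \sum_j y (dual_basis j) *: (vbasis {:H})`_j.
have yb f : y f = f b.
  have ly : linear (y : D -> K^o) by move=> c p q; rewrite /y c1 kP.
  rewrite {1}[f]dual_basis_sum (linear_sumZ ly) (linear_sumZ (linearP f)).
  by apply: eq_bigr => j _; exact: mulrC.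
have [||u bu] := @grouplike_in_G b.
- move=> f f'; rewrite -!yb {1}/y (rep_YM r) (Yv f') (linearZf _ _ (c2 f)).
  by rewrite Yv scalerA kv mulrC.
- by rewrite -yb /y (rep_Y1 r) -[v]scale1r kv.
have yu f : y f = f (i u) by rewrite yb bu.
have au : al a = chi u.
  have [l1|[a1 chiE]] := degenerateP; last by rewrite a1 chiE; case: hal.
  apply: (@ix_scalar_inj (a^-1 * u)%g) => //.
  apply: dual_separates => f.
  have := rep_XxY r f v.
  have hx : modX x v = 0 by rewrite Xv al0E hat_x scale0r.
  rewrite hx (linear0f (c2 _)) addr0 (Yv f) (linearZf _ _ (b2 x)) hx scaler0.
  rewrite (Xv (i a)) (linearZf _ _ (c2 _)) !Yv !yu scalerA -scalerDl -[al0 (i a)]/(al a).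
  rewrite sandwichE hit_rE T_x => /esym/eqP; rewrite scaler_eq0 (negPf v0) orbF.
  rewrite mulNr (raddfN f) subr_eq0 => /eqP e.
  rewrite !(linearZf _ _ (linearP f)) iM.
  transitivity (al a * (f (i a^-1%g * i u * x) : K)); first by [].
  have xu : i a^-1%g * x * i u = chi u *: (i a^-1%g * i u * x).
    by rewrite -mulrA x_iE -scalerAr mulrA.
  by rewrite e xu; exact: (linearZf _ _ (linearP f)).
exists al, u; split=> //; apply: mod_iso_sym.
have [[d1 d2] _ _] := one_dim_is_module hal au.
have [[e1 e2] _ _] := mV.
have lv : linear ((fun c : K^o => (c : K) *: v) : one_dim al u -> V).
  by move=> c p q; rewrite scalerDl -scalerA.
apply: (@mod_iso_of (one_dim al u) V (fun c : K^o => (c : K) *: v) (k : V -> K^o)) => //.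
move=> t c; move: t; apply: tens_eq => [||f h].
- exact: linear_comp lv (d1 c).
- exact: e1.
rewrite one_dim_act // double_act_tpure // (linearZf _ _ (b2 h)) Xv scalerA.
rewrite (linearZf _ _ (c2 f)) Yv scalerA yu al0E.
rewrite -[(_ * _) *: c]/((_ * _) * c); congr (_ *: v).
by rewrite mulrC [X in _ * X]mulrC mulrA.
Qed.

(** * Central group-like elements of the double *)

Lemma sandwich_hat u ga w : is_char ga ->
  sandwich u (hat ga) w = ((hat ga w : K) * (hat ga u : K)) *: hat ga.
Proof.
move=> hg; apply/lfunP => c; rewrite sandwichE scale_lfunE !hatM //.
by rewrite mulrAC.
Qed.

Lemma hat_T_x ga : is_char ga -> hat ga (T x) = 0 :> K.
Proof. by move=> hg; rewrite T_x (raddfN (hat ga)) /= hatM // hat_x mulr0 oppr0. Qed.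

Lemma sw3_eq0 (V : vectType K) (F : H -> H -> H -> V) h :
  (forall u v w, F u v w = 0) -> sw3 F h = 0.
Proof.
move=> e; rewrite /sw3 /sw2 /tlift big1 // => p _; rewrite big1 // => q _.
by rewrite big1 ?scaler0 // => p' _; rewrite big1 // => q' _; rewrite e scaler0.
Qed.

(** The element k' with (1 ⊗ k) (ga ⊗ 1) = ga ⊗ k' in the double. *)
Definition coadjoint ga (k : H) : H :=
  sw3 (fun u v w => ((hat ga (T w) : K) * (hat ga u : K)) *: v) k.

Lemma coadjoint_trilin ga :
  trilin (fun u v w : H => ((hat ga (T w) : K) * (hat ga u : K)) *: v).
Proof.
split=> [v w|u w|u v] c p q.
- by rewrite dual_linP mulrDr scalerDl mulrCA scalerA.
- by rewrite scalerDr !scalerA [_ * c]mulrC.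
- by rewrite T_lin dual_linP mulrDl scalerDl -mulrA scalerA.
Qed.

Lemma coadjoint_lin ga : linear (coadjoint ga). Proof. exact: sw3_lin. Qed.

Lemma coadjoint_1 ga : is_char ga -> coadjoint ga 1 = 1.
Proof.
case=> g1 gM; rewrite /coadjoint sw3_1; last exact: coadjoint_trilin.
by rewrite T1 !hat_1 g1 mulr1 scale1r.
Qed.

Lemma coadjoint_iM ga g k : is_char ga -> coadjoint ga (i g * k) = i g * coadjoint ga k.
Proof.
move=> hg; rewrite /coadjoint sw3_iM; last exact: coadjoint_trilin.
rewrite (sw3_comp _ _ (linear_mull _)); apply: eq_sw3 => u v w.
rewrite TM T_i hatM // hat_i hat_char_iM // -scalerAr; congr (_ *: _).
by rewrite -mulrA [ga g^-1%g * _]mulrA [ga g^-1%g * _]mulrC char_V // mul1r.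
Qed.

Lemma coadjoint_xM ga k : is_char ga ->
  coadjoint ga (x * k) = ga a^-1%g *: (x * coadjoint ga k).
Proof.
move=> hg; rewrite /coadjoint sw3_xM; last exact: coadjoint_trilin.
rewrite [X in X + _ + _]sw3_eq0 => [|u v w]; last by rewrite hat_xM mulr0 scale0r.
rewrite [X in _ + X]sw3_eq0 => [|u v w]; last first.
  by rewrite TM hatM // hat_T_x // mulr0 mul0r scale0r.
rewrite add0r addr0 scalerAl (sw3_comp _ _ (linear_mull _)); apply: eq_sw3 => u v w.
by rewrite TM T_i hatM // hat_i -scalerAl -scalerAr scalerA mulrAC mulrC.
Qed.

Lemma dbl_mul_hat (f : D) k ga h : is_char ga ->
  dbl_mul_pure f k (hat ga) h = tpure (dual_mul f (hat ga)) (coadjoint ga k * h).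
Proof.
move=> hg; rewrite dbl_mul_pureE.
have lin : linear (fun v : H => tpure (dual_mul f (hat ga)) (v * h)).
  exact: linear_comp (tpure_r _) (linear_mulr h).
rewrite (sw3_comp _ _ lin); apply: eq_sw3 => u v w.
rewrite sandwich_hat // (linearZf _ _ (dual_mul_r f)) (linearZf _ _ (tpure_l _)).
by rewrite -scalerAl (linearZf _ _ (tpure_r _)).
Qed.

Lemma coadjoint_pair ga g k : is_char ga -> ga a = chi g ->
  coadjoint ga k * i g = i g * k.
Proof.
move=> hg e; move: k; apply: linear_ext => [|||h k ek|k ek].
- exact: linear_comp (linear_mulr _) (coadjoint_lin ga).
- exact: linear_mull.
- by rewrite coadjoint_1 // mulr1 mul1r.
- by rewrite coadjoint_iM // -mulrA ek !mulrA (iC g).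
- rewrite coadjoint_xM // -scalerAl -mulrA ek !mulrA x_iE -scalerAl scalerA -e.
  by rewrite mulrC char_V // scale1r.
Qed.

Lemma tau_pair ga g k : is_char ga -> ga a = chi g ->
  tau ga k = i g^-1%g * sw2 (fun u v => (hat ga u : K) *: v) k * i g.
Proof.
move=> hg e.
have bF : bilin (fun u v : H => (hat ga u : K) *: v).
  split=> [v|u] c p q; first by rewrite dual_linP scalerDl scalerA.
  by rewrite scalerDr !scalerA mulrC.
move: k; apply: linear_ext => [|||h k ek|k ek].
- exact: lin_tau.
- exact: linear_comp (linear_mulr _) (linear_comp (linear_mull _) (@sw2_lin _ _)).
- by rewrite tau_1 // sw2_1 // hat_1; case: hg => -> _; rewrite scale1r mulr1 iVi.
- rewrite tau_iM // ek sw2_iM //.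
  have -> : sw2 (fun u v => (hat ga (i h * u) : K) *: (i h * v)) k
      = ga h *: (i h * sw2 (fun u v => (hat ga u : K) *: v) k).
    rewrite scalerAl (sw2_comp _ _ (linear_mull _)); apply: eq_sw2 => u v.
    by rewrite hat_char_iM // -scalerAr -scalerAl scalerA mulrC.
  by rewrite -scalerAr -scalerAl !mulrA (iC h).
- rewrite tau_xM // ek sw2_xM //.
  rewrite [X in X + _](_ : _ = 0) ?add0r; last first.
    by rewrite /sw2 /tlift big1 // => p _; rewrite big1 // => q _; rewrite hat_xM scale0r scaler0.
  have -> : sw2 (fun u v => (hat ga u : K) *: (x * v)) k
      = x * sw2 (fun u v => (hat ga u : K) *: v) k.
    by rewrite (sw2_comp _ _ (linear_mull _)); apply: eq_sw2 => u v; rewrite -scalerAr.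
  by rewrite !mulrA x_iE -!scalerAl scalerA e -chiM mulgV chi1 scale1r.
Qed.
Lemma hat_pair_comm ga g (f : D) : is_char ga -> ga a = chi g ->
  dual_mul (hat ga) (sandwich (i g) f (i g^-1%g)) = dual_mul f (hat ga).
Proof.
move=> hg e; apply/lfunP => c; rewrite !dual_mulE.
transitivity (f (tau ga c) : K^o).
  rewrite (tau_pair c hg e).
  have lf : linear (fun h => f (i g^-1%g * h * i g)).
    exact: linear_comp (linearP f) (linear_comp (linear_mulr _) (linear_mull _)).
  rewrite (sw2_comp _ _ lf); apply: (@eq_sw2 K^o) => u v.
  by rewrite sandwichE -scalerAr -scalerAl (linearZf _ _ (linearP f)).
rewrite (sw2_comp _ _ (linearP f)); apply: (@eq_sw2 K^o) => u v.
by rewrite (linearZf _ _ (linearP f)); exact: mulrC.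
Qed.

Lemma dual_comul_hat ga : is_char ga -> dual_comul (hat ga) = tpure (hat ga) (hat ga).
Proof.
move=> hg; rewrite [X in tpure X _]dual_basis_sum (linear_sumZ (tpure_l _)).
apply: eq_bigr => j _; rewrite [X in tpure _ X]dual_basis_sum (linear_sumZ (tpure_r _)).
by rewrite scaler_sumr; apply: eq_bigr => k _; rewrite hatM // scalerA.
Qed.

Lemma dbl_comulE (V : vectType K) (F : A -> A -> V) (f : D) h : bilin F ->
  tlift F (dbl_comul (tpure f h)) = tlift (fun f1 f2 : D =>
    sw2 (fun h1 h2 => F (tpure f2 h1) (tpure f1 h2)) h) (dual_comul f).
Proof.
move=> bF; rewrite dbl_comul_tpure (tlift_comp _ _ (tlift_linear F)).
apply: eq_tlift => f1 f2; rewrite (sw2_comp _ _ (tlift_linear F)).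
by apply: eq_sw2 => u v; rewrite tlift_tpure.
Qed.

Lemma dbl_counit_tpure (f : D) h : dbl_counit (tpure f h) = (f 1 : K) * (eps h : K).
Proof.
rewrite /dbl_counit tlift_tpure //; split=> [k|g] c p q; last by rewrite dual_linP mulrDr mulrCA.
by rewrite add_lfunE scale_lfunE mulrDl -mulrA.
Qed.

(** Centrality splits into two identities in H, [coadjoint_pair] for the factor H
    and [tau_pair] for its dual; on the generator x both say ga a = chi g. *)
Lemma central_grouplike_pair ga g : is_char ga -> ga a = chi g ->
  central_grouplike (tpure (hat ga) (i g) : A).
Proof.
move=> hg e; split.
- rewrite -[LHS]tlift_id -[bcomul _]/(dbl_comul _).
  rewrite dbl_comulE ?dual_comul_hat //; last exact: tpure_bilin.
  have bF (f1 f2 : D) : bilin (fun h1 h2 => tpure (tpure f2 h1 : A) (tpure f1 h2 : A)).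
    split=> [v|v]; first exact: linear_comp (tpure_l _) (tpure_r _).
    exact: linear_comp (tpure_r _) (tpure_r _).
  rewrite tlift_tpure ?sw2_i //; split=> [v c p q|v c p q]; apply: sw2_lincomb => h1 h2.
    by rewrite tpure_l tpure_r.
  by rewrite tpure_l tpure_l.
- rewrite -[bcounit _]/(dbl_counit _) dbl_counit_tpure hat_1 eps_i mulr1.
  by case: hg.
move=> b; rewrite -[bmul _ b]/(dbl_mul _ b) -[bmul b _]/(dbl_mul b _).
move: b; apply: tens_eq => [||f k]; [exact: dbl_mul_r|exact: dbl_mul_l|].
by rewrite !dbl_mul_tpure dbl_mul_i dbl_mul_hat // coadjoint_pair // hat_pair_comm.
Qed.

(** The maps p = id ⊗ eps and q = (evaluation at 1) ⊗ id satisfy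
    t = p t_(1) ⊗ q t_(2), so a group-like t is the pure tensor of f = p t and
    h = q t, which are group-like in their factors. Commuting with x then
    gives ga a = chi g, provided that x is nonzero. *)
Lemma central_grouplike_classification (t : A) : central_grouplike t ->
  exists ga g, [/\ is_char ga, t = tpure (hat ga) (i g) & (1 < l)%N -> ga a = chi g].
Proof.
move=> [tt t1 tC].
rewrite -[bcomul _]/(dbl_comul _) in tt; rewrite -[bcounit _]/(dbl_counit _) in t1.
have bp : bilin (fun (f : D) (h : H) => (eps h : K) *: f).
  split=> [h|f] c u v; first by rewrite scalerDr !scalerA mulrC.
  by rewrite dual_linP scalerDl scalerA.
have bq : bilin (fun (f : D) (h : H) => (f 1 : K) *: h).
  split=> [h|f] c u v; last by rewrite scalerDr !scalerA mulrC.
  by rewrite add_lfunE scale_lfunE scalerDl -scalerA.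
pose p : A -> D := tlift (fun (f : D) (h : H) => (eps h : K) *: f).
pose q : A -> H := tlift (fun (f : D) (h : H) => (f 1 : K) *: h).
have lp : linear p by exact: tlift_linear.
have lq : linear q by exact: tlift_linear.
have pE f h : p (tpure f h) = (eps h : K) *: f by rewrite /p tlift_tpure.
have qE f h : q (tpure f h) = (f 1 : K) *: h by rewrite /q tlift_tpure.
have tpq : t = tpure (p t) (q t).
  have bF : bilin (fun a1 a2 : A => tpure (p a1) (q a2) : A).
    by split=> [v|v]; [exact: linear_comp (tpure_l _) lp|exact: linear_comp (tpure_r _) lq].
  transitivity (tlift (fun a1 a2 : A => tpure (p a1) (q a2) : A) (dbl_comul t)); last first.
    by rewrite tt tlift_tpure.
  move: (t); apply: tens_eq => [||f h] //.
    exact: linear_comp (tlift_linear _) dbl_comul_lin.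
  rewrite dbl_comulE // -[in LHS](hit_r1 f) -(@dual_comul_evaluate _ (fun f2 => tpure f2 h)).
    apply: eq_tlift => f1 f2.
    rewrite -{1}[h]counitl (tlift_comp _ _ (tpure_r _)) -[tlift _ _]/(sw2 _ h).
    have l1 : linear (fun s : A => (f1 1 : K) *: s).
      by move=> c u v; rewrite scalerDr !scalerA mulrC.
    rewrite (sw2_comp _ _ l1); apply: eq_sw2 => u v; rewrite pE qE.
    rewrite (linearZf _ _ (tpure_l _)) !(linearZf _ _ (tpure_r _)).
    by rewrite !scalerA mulrC.
  exact: tpure_l.
set f := p t in tpq; set h := q t in tpq.
have f1h : (f 1 : K) * (eps h : K) = 1 by rewrite -dbl_counit_tpure -tpq.
have h0 : h != 0 by apply: contra_eq_neq f1h => ->; rewrite linear0 mulr0 eq_sym oner_eq0.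
have f1 : (f 1 : K) = 1.
  have : q t = (f 1 : K) *: h by rewrite {1}tpq qE.
  rewrite -/h -{1}[h]scale1r => /eqP; rewrite -subr_eq0 -scalerBl scaler_eq0 (negPf h0) orbF.
  by rewrite subr_eq0 => /eqP.
have h1 : (eps h : K) = 1 by move: f1h; rewrite f1 mul1r.
have fb (g : D) (b : H) : hit_r g b 1 = g b :> K by rewrite hit_rE mulr1.
have [u hu] : exists u, h = i u.
  apply: grouplike_in_G => // f' f''.
  have bF : bilin (fun a1 a2 : A => (f' (q a1) : K) * (f'' (q a2) : K) : K^o).
    split=> [v c s s'|v c s s']; rewrite lq dual_linP; first by rewrite mulrDl -mulrA.
    by rewrite mulrDr mulrCA.
  have := congr1 (@tlift K A A K^o (fun a1 a2 : A => (f' (q a1) : K) * (f'' (q a2) : K) : K^o)) tt.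
  rewrite [in RHS]tlift_tpure // -/h => <-; rewrite tpq dbl_comulE //.
  transitivity (@tlift K D D K^o (fun f1 f2 : D =>
      (f1 1 : K) *: ((f2 1 : K) *: (dual_mul f' f'' h : K^o))) (dual_comul f)).
    rewrite (@dual_comul_evaluate K^o (fun f2 : D => (f2 1 : K) *: (dual_mul f' f'' h : K^o))).
      by rewrite fb f1 scale1r.
    by move=> c g g'; rewrite add_lfunE scale_lfunE scalerDl -scalerA.
  apply: (@eq_tlift K D D K^o) => g g'.
  rewrite dual_mulE.
  have lZ : linear (fun s : K^o => ((g 1 : K) * (g' 1 : K)) *: s).
    by move=> c s s'; rewrite scalerDr !scalerA mulrC.
  transitivity (((g 1 : K) * (g' 1 : K)) *: (sw2 (fun s s' => (f' s : K) * (f'' s' : K) : K^o) h)).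
    exact: mulrA.
  rewrite (@sw2_comp K^o K^o _ _ _ lZ); apply: (@eq_sw2 K^o) => s s'.
  rewrite !qE (linearZf _ _ (linearP f')) (linearZf _ _ (linearP f'')).
  transitivity (((g' 1 : K) * (f' s : K)) * ((g 1 : K) * (f'' s' : K))) => //.
  rewrite mulrACA; congr (_ * _); exact: mulrC.
have [hf fE] : is_char (fun g => f (i g)) /\ f = hat (fun g => f (i g)).
  apply: multiplicative_hat => // b c.
  have bF : bilin (fun a1 a2 : A => (p a1 c : K) * (p a2 b : K) : K^o).
    split=> [v k s s'|v k s s']; rewrite lp add_lfunE scale_lfunE.
      by rewrite mulrDl -mulrA.
    by rewrite mulrDr mulrCA.
  have := congr1 (@tlift K A A K^o (fun a1 a2 : A => (p a1 c : K) * (p a2 b : K) : K^o)) tt.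
  rewrite [in RHS]tlift_tpure // -/f [X in _ = X]mulrC => <-; rewrite tpq dbl_comulE //.
  transitivity (@tlift K D D K^o (fun f1 f2 : D => (f1 b : K) *: (f2 c : K^o)) (dual_comul f)).
    rewrite (@dual_comul_evaluate K^o (fun f2 : D => f2 c : K^o)) ?hit_rE //.
    by move=> k g g'; rewrite add_lfunE scale_lfunE.
  apply: (@eq_tlift K D D K^o) => g g'.
  have lpc (g0 : D) (c0 : H) : linear (fun s => p (tpure g0 s) c0 : K^o).
    by move=> k s s'; rewrite tpure_r lp add_lfunE scale_lfunE.
  rewrite hu sw2_i; last first.
    split=> v k s s'; rewrite lpc; first by rewrite mulrDl -mulrA.
    by rewrite mulrDr mulrCA.
  rewrite !pE !eps_i !scale1r; exact: (@mulrC K).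
set ga := (fun g => f (i g)) in hf fE.
exists ga, u; split=> // [|l1]; first by rewrite -fE -hu.
have tCx : dbl_mul t (tpure (eps : D) x) = dbl_mul (tpure (eps : D) x) t := tC _.
have := congr1 q tCx; rewrite tpq hu fE !dbl_mul_tpure dbl_mul_i dbl_mul_hat // !qE.
rewrite dual_1mul -[x in coadjoint _ x]mulr1 coadjoint_xM // coadjoint_1 // mulr1.
have -> : dual_mul (hat ga) (sandwich (i u) eps (i u^-1%g)) = hat ga.
  rewrite -[RHS]dual_mul1; congr (dual_mul _ _); apply/lfunP => c.
  by rewrite sandwichE !counitM !eps_i mul1r mulr1.
rewrite -fE f1 !scale1r -scalerAl x_iE scalerA -[LHS]scale1r => /(ix_scalar_inj l1) /esym e.
by rewrite -[LHS]mulr1 -e mulrA char_V // mul1r.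
Qed.

(** * Modules over the quotient by the central group-like elements *)

(** The ideal is generated by the elements t - 1 with t central group-like: on the
    span of these t, an action in which they are trivial is the counit. *)
Lemma bar_moduleP (M : preModule A) : is_module M ->
  bar_module M <-> forall t, central_grouplike t -> forall m : M, act t m = m.
Proof.
move=> mM; have [[b1 b2] m1 mm] := mM; have ct : is_char (fun _ : G => 1 : K).
  by split=> *; rewrite ?mulr1.
have c1 : @central_grouplike K A (bone A).
  have := @central_grouplike_pair (fun _ => 1) 1%g ct; rewrite hat_eps i1 chi1.
  by apply.
split=> [bM t ct' m|tM z [n [b [y [yP ->]]]] m].
  have z0 : central_ideal (bmul (bone A) (t - bone A)).
    exists 1%N, (fun _ => bone A), (fun _ => t - bone A); rewrite big_ord1; split=> // _.
    split; first exists [:: t; bone A].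
    - by move=> g; rewrite !inE => /orP[] /eqP ->.
    - by rewrite memvB ?memv_span // !inE eqxx ?orbT.
    have lc : linear (@bcounit K A : A -> K^o) by exact: tlift_linear.
    rewrite -scaleN1r addrC lc; case: ct' => _ -> _; case: c1 => _ -> _.
    by rewrite -[LHS]/((-1) * 1 + 1) mulr1 addNr.
  have := bM _ z0 m; rewrite mm m1 -scaleN1r addrC b1 m1 scaleN1r => /eqP.
  by rewrite addrC subr_eq0 => /eqP.
rewrite (linear_sum_ord _ (b1 m)) big1 // => j _; rewrite mm.
suff -> : act (y j) m = 0 by rewrite (linear0f (b2 _)).
have [[s sP ys] y0] := yP j.
have lc : linear (@bcounit K A : A -> K^o) by exact: tlift_linear.
have : act (y j) m = (bcounit (y j) : K) *: m.
  apply: (@span_ind K A (fun t : A => act t m = (bcounit t : K) *: m) s _ _ _ (y j)) => //.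
  - by rewrite (linear0f (b1 m)) (linear0f lc) scale0r.
  - move=> c u v eu ev; rewrite b1 eu ev lc scalerDl -[(c *: _ : K^o)]/(c * _ : K).
    by rewrite scalerA.
  - by move=> u /sP cu; rewrite tM //; case: cu => _ -> _; rewrite scale1r.
by rewrite y0 scale0r.
Qed.

(** * Weights *)

(** An eigenvector of the commutative subalgebra generated by G and the functions
    on G; its characters are the pairs (lam, u). *)
Definition weight_vector (M : preModule A) (v : M) (lam : G -> K) (u : G) : Prop :=
  [/\ v != 0, forall g, modX (i g) v = lam g *: v
    & forall phi, modY (hat phi) v = phi u *: v].

Lemma hatZ c phi : hat (fun g => c * phi g) = c *: hat phi.
Proof.
by rewrite /hat scaler_sumr; apply: eq_bigr => w _; rewrite scalerA.
Qed.

Lemma dual_mul_hat phi psi : dual_mul (hat phi) (hat psi) = hat (fun g => phi g * psi g).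
Proof.
apply/lfunP => h; rewrite dual_mulE; move: h phi psi; apply: left_ind.
- move=> c h k eh ek phi psi; rewrite sw2_lin eh ek.
  by rewrite (linearP (hat (fun g => phi g * psi g))).
- by move=> phi psi; rewrite sw2_1 ?hat_1 //; exact: bilin_fg.
- move=> g h e phi psi; rewrite sw2_iM ?hat_iM -?e; last exact: bilin_fg.
  by apply: (@eq_sw2 K^o) => u v; rewrite !hat_iM.
- move=> h e phi psi; rewrite sw2_xM ?hat_xM; last exact: bilin_fg.
  rewrite /sw2 /tlift !big1 ?addr0 // => p _; rewrite big1 // => q _.
    by rewrite hat_xM mulr0 scaler0.
  by rewrite hat_xM mul0r scaler0.
Qed.

Lemma sandwich_i_hat g phi : sandwich (i g) (hat phi) (i g^-1%g) = hat phi.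
Proof.
apply/lfunP => c; rewrite sandwichE; move: c phi; apply: left_ind.
- move=> c h k eh ek phi; rewrite mulrDr mulrDl -scalerAr -scalerAl.
  by rewrite !dual_linP eh ek.
- by move=> phi; rewrite mulr1 iVi.
- by move=> k h e phi; rewrite mulrA (iC _ k) -!mulrA [LHS]hat_iM [RHS]hat_iM mulrA e.
- by move=> h e phi; rewrite -!mulrA hat_iM !hat_xM.
Qed.

Hypothesis splits :
  forall n, (0 < n)%N -> exists rs : seq K, 'X^n - 1 = \prod_(r <- rs) ('X - r%:P).

(** The indicator functions of the points of G act by projections that sum to the
    identity, so one of them has a nonzero image; this image is G-stable and
    contains a common eigenvector of G. *)
Lemma weight_exists (M : preModule A) : is_module M -> ({:M} != 0)%VS ->
  exists (v : M) lam u, is_char lam /\ weight_vector v lam u.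
Proof.
move=> mM M0; have r := module_rep mM.
have [b1 b2] := rep_Xbilin r; have [c1 c2] := rep_Ybilin r.
pose d u : G -> K := fun w => (w == u)%:R.
have [u Wu0] : exists u, (limg (linfun (modY (hat (d u)) : M -> M)) != 0)%VS.
  apply: contrapT => hn; move: M0; rewrite -vpick0 => /negP; apply; apply/eqP.
  have hE : hat (fun w => \sum_u d u w) = eps :> D.
    rewrite -hat_eps; congr hat; apply: funext => w.
    by rewrite (bigD1 w) //= big1 ?addr0 /d ?eqxx // => u; rewrite eq_sym => /negPf ->.
  rewrite -(rep_Y1 r (vpick _)) -hE.
  have -> : hat (fun w => \sum_u d u w) = \sum_u hat (d u).
    by rewrite /hat exchange_big; apply: eq_bigr => w _; rewrite scaler_suml.
  pose Yv := fun f => modY f (vpick {:M}).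
  have lY : linear Yv by exact: c1.
  pose Y' : {linear D -> M} := HB.pack Yv (GRing.isLinear.Build K D M *:%R Yv lY).
  rewrite -[LHS]/(Y' _) linear_sum big1 // => u _.
  apply: contrapT => /eqP hu; apply: hn; exists u.
  apply: contraNneq hu => e; rewrite -memv0 -e.
  have -> : Y' (hat (d u)) = linfun (modY (hat (d u)) : M -> M) (vpick {:M}).
    by rewrite linfunE //; exact: c2.
  by rewrite memv_img ?memvf.
pose rho g : 'End(M) := linfun (modX (i g) : M -> M).
have rE g m : rho g m = modX (i g) m by rewrite linfunE //; exact: b2.
have [|||v [lam [/memv_imgP[m _ vE] v0 hlam vlam]]] :=
  common_eigenvector abG splits (rho := rho) _ _ _ Wu0.
- by move=> m; rewrite rE i1 (rep_X1 r).
- by move=> g h m; rewrite !rE iM (rep_XM r).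
- move=> g _ /memv_imgP[m _ ->]; rewrite linfunE ?rE ?(rep_XiY r) ?sandwich_i_hat; last exact: c2.
  rewrite -(@linfunE _ _ _ (modY (hat (d u)) : M -> M)); last exact: c2.
  by rewrite memv_img ?memvf.
exists v, lam, u; split=> //; split=> // [g|phi]; first by rewrite -rE vlam.
rewrite vE linfunE; last exact: c2.
rewrite -(rep_YM r) dual_mul_hat -(linearZf _ _ (c1 m)) -hatZ; congr modY; congr hat.
apply: funext => w; rewrite /d; case: eqP => [->//|_]; by rewrite !mulr0.
Qed.

Lemma hit_r_hat phi u : hit_r (hat phi) (i u) = hat (fun w => phi (u * w)%g).
Proof. by apply/lfunP => c; rewrite hit_rE hat_iM. Qed.

Lemma twisted_weight al w (M : preModule A) (v : M) lam u : is_char al -> is_module M ->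
  weight_vector v lam u ->
  @weight_vector (twisted al w M) v (fun g => lam g * al g) (w * u)%g.
Proof.
move=> ha mM [v0 vX vY]; have [[b1 b2] _ _] := mM; split=> // [g|phi].
  rewrite /modX /= twist_tpure tau_i //.
  have -> : hit_r (eps : D) (i w) = eps by apply/lfunP => c; rewrite hit_rE eps_iM.
  rewrite (linearZf _ _ (tpure_r _)) (linearZf _ _ (b1 v)).
  by rewrite -[act _ v]/(modX (i g) v) vX scalerA mulrC.
rewrite /modY /= twist_tpure tau_1 // hit_r_hat.
exact: vY.
Qed.

Lemma pair_act (M : preModule A) (v : M) lam u ga g : is_module M ->
  weight_vector v lam u -> act (tpure (hat ga) (i g) : A) v = (ga u * lam g) *: v.
Proof.
move=> mM [_ vX vY]; have r := module_rep mM.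
have [_ c2] := rep_Ybilin r.
by rewrite double_act_tpure // vX (linearZf _ _ (c2 _)) vY scalerA mulrC.
Qed.

(** The scalar is ga (a^k) * chi (g^-1)^k = (ga a / chi g)^k, which is 1 because
    ga a = chi g. *)
Lemma central_acts_trivially (M : preModule A) (v : M) k t : is_module M ->
  weight_vector v (fun g => chi g^-1%g ^+ k) (a ^+ k)%g -> central_grouplike t ->
  act t v = v.
Proof.
move=> mM wv /central_grouplike_classification[ga [g [hg -> e]]].
rewrite (pair_act ga g mM wv) char_X // -exprMn.
suff -> : ga a * chi g^-1%g = 1 by rewrite expr1n scale1r.
case: degenerateP => [l1|[-> ->]]; last by case: hg => ->; rewrite mulr1.
by rewrite e // -chiM mulgV chi1.
Qed.

(** The fixed vectors of a central element form a submodule. *)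
Lemma bar_simple (M : preModule A) (v : M) k : simple_module M ->
  weight_vector v (fun g => chi g^-1%g ^+ k) (a ^+ k)%g -> bar_module M.
Proof.
move=> [mM M0 Ms] wv; apply/(bar_moduleP mM) => t ct m.
have [[b1 b2] _ mm] := mM.
pose U : {vspace M} := lker (linfun (act t : M -> M) - \1)%VF.
have memU w : (w \in U) = (act t w == w).
  by rewrite memv_ker add_lfunE opp_lfunE id_lfunE linfunE ?subr_eq0.
have [b w|U0|UT] := Ms U.
- by rewrite !memU => /eqP e; rewrite -mm; case: ct => _ _ ->; rewrite mm e.
- have : v \in U by rewrite memU (central_acts_trivially mM wv ct).
  by rewrite U0 memv0; case: wv => /negPf ->.
- by apply/eqP; rewrite -memU UT memvf.
Qed.

(** * The map Phi *)

Lemma Phi_one_dim (U : preModule A) al u : is_char al -> al a = chi u -> is_module U ->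
  Phi (isoclass U) (isoclass (one_dim al u)) = isoclass (twisted al u U).
Proof.
move=> ha au mU; rewrite Phi_isoclass //; last exact: one_dim_is_module.
by apply/isoclass_eq; exact: tensor_one_dim.
Qed.

Lemma simples1P (C : modClass A) : simples1 C ->
  exists al u, [/\ is_char al, al a = chi u & C = isoclass (one_dim al u)].
Proof.
move=> [V [[mV _ _] dV ->]]; have [al [u [ha au iso]]] := one_dim_classification mV dV.
by exists al, u; split=> //; apply/isoclass_eq.
Qed.

Lemma one_dim_simples1 al u : is_char al -> al a = chi u ->
  simples1 (isoclass (one_dim al u)).
Proof.
move=> ha au; exists (one_dim al u); split=> //; first exact: one_dim_simple.
exact: dim_one_dim.
Qed.

Lemma twist_trivial al t : (forall g, al g = 1) -> twist al (a ^+ 0)%g t = t.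
Proof.
move=> a1; have -> : al = fun _ => 1 by apply: funext.
move: t; apply: tens_eq => [||f h] //; first exact: twist_lin.
rewrite twist_tpure expg0 i1 hit_r1; congr tpure.
by rewrite /tau hat_eps; exact: counitr.
Qed.

Lemma iso_reparametrize (M M' : vectType K) (p : A -> M -> M) (p' : A -> M' -> M')
    (s s' : A -> A) : cancel s' s ->
  mod_iso (@PreModule K A M (fun t m => p (s t) m)) (@PreModule K A M' (fun t m => p' (s t) m)) ->
  mod_iso (@PreModule K A M p) (@PreModule K A M' p').
Proof.
by move=> sK [f [fb fa]]; exists f; split=> //= t m; rewrite -[t]sK; exact: fa.
Qed.

Lemma twisted_iso_cancel al u (U U' : preModule A) : is_char al ->
  mod_iso (twisted al u U) (twisted al u U') -> mod_iso U U'.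
Proof.
case: U U' => [M p] [M' p'] ha; exact: (iso_reparametrize (twistKV u ha)).
Qed.

Lemma Phi_maps_simples : Phi_maps A.
Proof.
move=> _ C' [U [sU _ ->]] /simples1P[al [u [ha au ->]]].
exists (twisted al u U); first exact: twisted_simple.
by apply: Phi_one_dim => //; case: sU.
Qed.

Lemma iso_scalar (M M' : preModule A) (t : A) (v : M) c d : mod_iso M M' -> v != 0 ->
  act t v = c *: v -> (forall m : M', act t m = d *: m) -> c = d.
Proof.
move=> [f [fb fa]] v0 tv tM'; have := fa t v; rewrite tv tM' linearZ /= => /eqP.
rewrite -subr_eq0 -scalerBl scaler_eq0 subr_eq0 => /orP[/eqP//|fv].
by move: v0; rewrite -(inj_eq (bij_inj fb)) linear0 fv.
Qed.

Lemma one_dim_iso al u al' u' : is_char al -> is_char al' ->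
  mod_iso (one_dim al u) (one_dim al' u') -> al =1 al' /\ u = u'.
Proof.
move=> ha ha' iso.
have sc (f : D) h : (f (i u) : K) * (hat al h : K) = (f (i u') : K) * (hat al' h : K).
  apply: (@iso_scalar (one_dim al u) (one_dim al' u') (tpure f h : A) (1 : K^o) _ _ iso).
  - exact: oner_neq0.
  - exact: one_dim_act.
  - by move=> m; exact: one_dim_act.
split=> [g|].
  by have := sc eps (i g); rewrite !eps_i !mul1r !hat_i.
apply: i_inj; apply: dual_separates => f.
have := sc f 1; rewrite !hat_1; case: ha => -> _; case: ha' => -> _.
by rewrite !mulr1.
Qed.

(** If q^(2k) = 1 then (chi^-k, a^k) is a one-dimensional module W over the
    quotient, and Phi sends ([W], [1]) and ([1], [W]) to the same class. *)
Lemma Phi_injective_order k : Phi_injective A -> chi a ^+ k * chi a ^+ k = 1 ->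
  (forall g, chi g ^+ k = 1) /\ (a ^+ k = 1)%g.
Proof.
move=> inj q2k.
pose al n := fun g : G => chi g^-1%g ^+ n.
have hal n : is_char (al n) by apply: charXn; exact: char_inv.
have qn0 n : chi a ^+ n != 0 by rewrite expf_neq0 // (char_neq0 a chi_char).
have cond n : chi a ^+ n * chi a ^+ n = 1 -> al n a = chi (a ^+ n)%g.
  move=> e; rewrite (char_X _ _ chi_char) /al; apply: (mulIf (qn0 n)).
  by rewrite -exprMn [chi _ * _]mulrC (char_V a chi_char) expr1n e.
have c0 : al 0%N a = chi (a ^+ 0)%g by apply: cond; rewrite mulr1.
have ck := cond k q2k.
have wt n : al n a = chi (a ^+ n)%g ->
    @weight_vector (one_dim (al n) (a ^+ n)%g) (1 : K^o) (al n) (a ^+ n)%g.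
  move=> e; split=> [|g|phi]; first exact: oner_neq0.
    by rewrite /modX one_dim_act // eps_i mul1r hat_i.
  by rewrite /modY one_dim_act // hat_i hat_1 (hal n).1 mulr1.
have bar n : al n a = chi (a ^+ n)%g -> simples_bar (isoclass (one_dim (al n) (a ^+ n)%g)).
  move=> e; exists (one_dim (al n) (a ^+ n)%g).
  have s := one_dim_simple (hal n) e; split=> //; exact: bar_simple s (wt n e).
have /isoclass_eq iso :
    isoclass (one_dim (al k) (a ^+ k)%g) = isoclass (one_dim (al 0%N) (a ^+ 0)%g).
  apply: (fun e => (inj _ _ _ _ (bar k ck) (one_dim_simples1 (hal 0%N) c0)
    (bar 0%N c0) (one_dim_simples1 (hal k) ck) e).1).
  have a01 g : al 0%N g = 1 by rewrite /al expr0.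
  have E (t : A) (c : trivial_module) :
      act (twist (al k) (a ^+ k)%g (twist (al 0%N) (a ^+ 0)%g t)) c
      = act (twist (al 0%N) (a ^+ 0)%g (twist (al k) (a ^+ k)%g t)) c.
    by rewrite (twist_trivial t a01) (twist_trivial (twist (al k) (a ^+ k)%g t) a01).
  have P1 := Phi_one_dim (hal 0%N) c0 (one_dim_is_module (hal k) ck).
  have P2 := Phi_one_dim (hal k) ck (one_dim_is_module (hal 0%N) c0).
  apply: (etrans P1 (etrans _ (esym P2))); apply/isoclass_eq.
  exact: (eq_act_iso E).
have [ek ->] := one_dim_iso (hal k) (hal 0%N) iso; split=> // g.
by have := ek g^-1%g; rewrite /al invgK expr0.
Qed.

Section OddEqual.
Hypothesis odd_l : odd l.
Hypothesis chil : forall g, chi g ^+ l = 1.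
Hypothesis a_pow_l : (a ^+ l = 1)%g.

Lemma char_a_pow ga : is_char ga -> exists m : nat, ga a = chi a ^+ m.
Proof.
move=> hg; have [|j ->] := prim_rootP hl (x := ga a); last by exists j.
by rewrite -char_X // a_pow_l; case: hg.
Qed.

Lemma chi_pow g : exists m : nat, chi g = chi a ^+ m.
Proof. by have [|j ->] := prim_rootP hl (x := chi g) => //; exists j. Qed.

(** The pairs (ga, g) used are (chi, a), whose scalars are the squares of the
    chi u_i, then (chi^m, g) with chi g = q^m, and (ga, a^m) with ga a = q^m. *)
Lemma pair_separation al1 u1 al2 u2 :
  is_char al1 -> is_char al2 -> al1 a = chi u1 -> al2 a = chi u2 ->
  (forall ga g, is_char ga -> ga a = chi g -> ga u1 * al1 g = ga u2 * al2 g) ->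
  al1 =1 al2 /\ u1 = u2.
Proof.
move=> h1 h2 e1 e2 pairs.
have chiu : chi u1 = chi u2.
  by apply: (odd_square_root odd_l) => //; rewrite -{2}e1 -{2}e2; exact: pairs.
have eal : al1 =1 al2.
  move=> g; have [m em] := chi_pow g.
  have := pairs _ g (charXn m chi_char) (esym em); rewrite chiu.
  by apply: mulfI; rewrite expf_neq0 // char_neq0.
split=> //; apply/eqP; rewrite eq_mulgV1; apply/eqP.
apply: (char_separation abG splits charK) => ga hg.
have [m em] := char_a_pow hg.
have := pairs ga (a ^+ m)%g hg; rewrite (char_X _ _ chi_char) => /(_ em).
rewrite eal => /(mulIf (char_neq0 _ h2)) e.
by have [_ gM] := hg; rewrite gM e char_V.
Qed.

(** Central group-like elements act trivially on U1 and U2, so they act on the two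
    tensor products by the scalars of [pair_separation]. *)
Lemma Phi_injective_odd : Phi_injective A.
Proof.
move=> C1 C1' C2 C2' [U1 [s1 b1 ->]] /simples1P[al1 [u1 [h1 e1 ->]]].
move=> [U2 [s2 b2 ->]] /simples1P[al2 [u2 [h2 e2 ->]]].
have [m1 U10 _] := s1; have [m2 _ _] := s2.
move=> e; have := etrans (esym (Phi_one_dim h1 e1 m1)) (etrans e (Phi_one_dim h2 e2 m2)).
move=> {e} /isoclass_eq iso.
have act_pair al u (U : preModule A) ga g (m : U) : is_char al -> is_module U ->
    bar_module U -> is_char ga -> ga a = chi g ->
    act (tpure (hat ga) (i g) : A) (m : twisted al u U) = (ga u * al g) *: m.
  move=> ha mU bU hg e; rewrite /= twist_tpure tau_i //.
  have -> : hit_r (hat ga) (i u) = ga u *: hat ga :> D.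
    by rewrite hit_r_hat -hatZ; congr hat; apply: funext => w; case: hg => _ ->.
  have [[c1 _] _ _] := mU.
  rewrite (linearZf _ _ (tpure_l _)) (linearZf _ _ (tpure_r _)) scalerA (linearZf _ _ (c1 m)).
  congr (_ *: _); exact: ((bar_moduleP mU).1 bU _ (central_grouplike_pair hg e)).
have [] := @pair_separation al1 u1 al2 u2 h1 h2 e1 e2.
  move=> ga g hg e.
  have v0 : vpick {:U1} != 0 by rewrite vpick0.
  apply: (@iso_scalar (twisted al1 u1 U1) (twisted al2 u2 U2) _ (vpick {:U1}) _ _ iso v0).
    exact: act_pair.
  by move=> m; exact: act_pair.
move=> /funext eal eu; subst al2 u2; split=> //; apply/isoclass_eq.
exact: twisted_iso_cancel h1 iso.
Qed.

(** E is the tensor product of E ⊗ V^-1 and V, where V is chosen such that a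
    weight of E ⊗ V^-1 has the form (chi^-k, a^k). *)
Lemma Phi_surjective_odd : Phi_surjective A.
Proof.
move=> _ [E sE ->]; have [mE E0 _] := sE.
have [v [lam [u [hlam wv]]]] := weight_exists mE E0.
have [n en] := char_a_pow hlam; have [m em] := chi_pow u.
have [k ek] : exists k, chi a ^+ n * chi a ^+ k * chi a ^+ k = chi a ^+ m.
  pose h := l./2; pose j := (m + n * (2 * h))%N.
  have lE : l = (2 * h + 1)%N by rewrite -[LHS]odd_double_half odd_l addnC -mul2n.
  (* With l = 2h + 1, multiplication by h + 1 halves exponents modulo l. *)
  exists (j * (h + 1))%N; rewrite -!exprD.
  have -> : (n + j * (h + 1) + j * (h + 1) = m + l * (n + j))%N.
    by rewrite {1}lE /j; ring.
  by rewrite exprD exprM chil expr1n mulr1.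
pose al g := lam g * chi g ^+ k.
pose w := (u * (a ^+ k)^-1)%g.
have hal : is_char al by apply: charM => //; exact: charXn chi_char.
have qk0 : chi a ^+ k != 0 by rewrite expf_neq0 // (char_neq0 a chi_char).
have ew : al a = chi w.
  apply: (mulIf qk0); rewrite /al en ek /w chiM em -mulrA.
  by rewrite -(char_X a k chi_char) [chi _^-1%g * _]mulrC (char_V _ chi_char) mulr1.
pose al' g := al g^-1%g.
have hal' : is_char al' by exact: char_inv.
have ew' : al' a = chi w^-1%g.
  apply: (mulfI (char_neq0 a hal)); rewrite /al' (char_V a hal) ew.
  by rewrite (char_V w chi_char).
pose U := twisted al' w^-1%g E.
have sU : simple_module U by exact: twisted_simple.
have mU : is_module U by case: sU.
have wU : @weight_vector U v (fun g => chi g^-1%g ^+ k) (a ^+ k)%g.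
  have := twisted_weight w^-1%g hal' mE wv.
  have -> : (w^-1 * u = a ^+ k)%g by rewrite /w invMg invgK -mulgA mulVg mulg1.
  have -> // : (fun g => lam g * al' g) = (fun g => chi g^-1%g ^+ k).
  by apply: funext => g; rewrite /al' /al mulrA char_V // mul1r.
exists (isoclass U), (isoclass (one_dim al w)); split.
- by exists U; split=> //; exact: bar_simple sU wU.
- exact: one_dim_simples1.
rewrite Phi_one_dim //; apply/isoclass_eq.
have e (t : A) (m0 : E) : act (twist al' w^-1%g (twist al w t)) m0 = act t m0.
  rewrite (twistK hal hal') // => [g|]; first exact: char_V.
  by rewrite mulgV.
exact: (eq_act_iso e).
Qed.
End OddEqual.

(** Applying [Phi_injective_order] to k = l / 2 excludes an even l, and applying
    it to k = l bounds the orders of chi and a by l. *)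
Lemma Phi_bijective_iff (N M : nat) : N = #[a]%g -> char_order chi M ->
  Phi_injective A /\ Phi_surjective A <-> [/\ odd l, l = M & M = N].
Proof.
move=> hN [M0 chiM1 Mmin]; split=> [[inj _]|[ol lM MN]]; last first.
  have chil g : chi g ^+ l = 1 by rewrite lM.
  have al1 : (a ^+ l = 1)%g by rewrite lM MN hN expg_order.
  by split; [exact: Phi_injective_odd|exact: Phi_surjective_odd].
have ql : chi a ^+ l = 1 by exact: prim_expr_order hl.
have ol : odd l.
  apply: contraT => el.
  have lE : (l./2 + l./2 = l)%N by rewrite addnn -[RHS]odd_double_half (negPf el).
  have [|c1 _] := Phi_injective_order (k := l./2) inj; first by rewrite -exprD lE.
  have : (l %| l./2)%N by rewrite (prim_order_dvd hl) c1.
  have h0 : (0 < l./2)%N by rewrite -double_gt0 -addnn lE l_gt0.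
  move=> /(dvdn_leq h0); rewrite -[X in (X <= _)%N]lE -[X in (_ <= X)%N]addn0.
  by rewrite leq_add2l leqNgt h0.
have [|c1 a1] := Phi_injective_order (k := l) inj; first by rewrite ql mulr1.
have Ml : l = M.
  apply/eqP; rewrite eqn_leq Mmin ?l_gt0 // andbT.
  by apply: dvdn_leq => //; rewrite (prim_order_dvd hl) chiM1.
split=> //; rewrite -Ml hN; apply/eqP; rewrite eqn_dvd order_dvdn a1 eqxx andbT.
by rewrite (prim_order_dvd hl) -(char_X _ _ chi_char) expg_order chi1.
Qed.

End DatumAlgebra.

Theorem theorem3p10 (K : closedFieldType) (charK : [pchar K] =i pred0)
    (G : finGroupType) (abG : abelian [set: G])
    (chi : G -> K) (chi1 : chi 1%g = 1)
    (chiM : forall g h : G, chi (g * h)%g = chi g * chi h) (a : G)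
    (l N M : nat) (hl : l.-primitive_root (chi a)) (hN : N = #[a]%g)
    (hM : char_order chi M)
    (* If [l = 1] then [x = 0] and [H = K[G]], for which [Phi] is always
       bijective: the equivalence fails unless [chi] and [a] are trivial. *)
    (hdeg : l = 1%N -> N = 1%N /\ M = 1%N)
    (H : hopfAlg K) (i : G -> H) (x : H) (hH : is_hopf_of_datum chi a l i x) :
  let A := drinfeld_double H in
  Phi_maps A /\
  (Phi_injective A /\ Phi_surjective A <-> [/\ odd l, l = M & M = N]).
Proof.
move=> A.
have degenerate : l = 1%N -> a = 1%g /\ forall g, chi g = 1.
  move=> /hdeg [N1 M1]; split; first by apply/eqP; rewrite -order_eq1 -hN N1.
  by move=> g; have [_ + _] := hM; rewrite M1 => /(_ g).
split; first exact: (Phi_maps_simples charK abG chi1 chiM hl hH degenerate).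
exact: (Phi_bijective_iff charK abG chi1 chiM hl hH degenerate (@unity_splits K) hN hM).
Qed.
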